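(* Let $S_+(\mathbb R^d)$ be the set of symmetric positive definite real $d\times d$ matrices and let $\Phi:\mathbb R^{2d}\times S_+(\mathbb R^d)^2\to\mathbb R$ be given by $$\Phi(\mu,\nu,A,B)=\|\mu-\nu\|^2+\mathrm{tr}(A)+\mathrm{tr}(B)-2\,\mathrm{tr}\big((A^{1/2}BA^{1/2})^{1/2}\big).$$ Then $\Phi$ is Fréchet differentiable and its derivative at $(\mu,\nu,A,B)\in\mathbb R^{2d}\times S_+(\mathbb R^d)^2$ is the linear map in $L(\mathbb R^{2d}\times\mathbb R^{2(d\times d)},\mathbb R)$ given by $$\begin{aligned}D_{(\mu,\nu,A,B)}\Phi[(g,g',G,G')]={}&2(\mu-\nu)\cdot(g-g')+\mathrm{tr}\,G+\mathrm{tr}\,G'\\&-\sum_{l=1}^d\kappa_l^{1/2}\sum_{i=1}^d\lambda_i^{-1}q_l^tP_iGP_iq_l-\sum_{l=1}^d\kappa_l^{-1/2}q_l^t\sqrt A\,G'\sqrt A\,q_l\\&-\sum_{l=1}^d\kappa_l^{1/2}\sum_{\substack{i,m=1\\ \lambda_i\neq\lambda_m}}^d(\lambda_i\lambda_m)^{-1/2}q_l^tP_iGP_mq_l\end{aligned}$$ for all $g,g'\in\mathbb R^d$ and $G,G'\in\mathbb R^{d\times d}$, where $A=\sum_{i=1}^d\lambda_iP_i$ and $A^{1/2}BA^{1/2}=\sum_{i=1}^d\kappa_iQ_i$ are the eigenvalue decompositions with $\lambda_i,\kappa_i>0$, $P_iP_j=\delta_{ij}P_i$, $Q_iQ_j=\delta_{ij}Q_i$,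 and $P_i=p_ip_i^t$, $Q_i=q_iq_i^t$ one-dimensional orthogonal projections.
   Context: Square roots of symmetric positive definite matrices are the spectral ones. $S_+(\mathbb R^d)$ is viewed as a subset of $L(\mathbb R^d,\mathbb R^d)\simeq\mathbb R^{d\times d}$, and the square root is extended to matrices $A'$ in a neighbourhood of a given $A\in S_+(\mathbb R^d)$ by the holomorphic functional calculus $A'^{1/2}=\frac1{2\pi i}\int_\Gamma z^{1/2}(zI-A')^{-1}dz$ with $z^{1/2}$ the principal branch on $\mathbb C\setminus(-\infty,0]$ and $\Gamma$ the smooth boundary of a bounded open set $\Omega$ containing the spectrum, with $\overline\Omega\subset\mathbb C\setminus(-\infty,0]$; $\Phi$ is extended correspondingly. Repeated eigenvalues are listed according to multiplicity. $L(X,Y)$ denotes continuous linear maps $X\to Y$.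
   Formalization: The last sum is taken over i ≠ m instead of λ_i ≠ λ_m, since the printed formula fails when A has a repeated eigenvalue (e.g. A = I, d = 2); the printed condition λ_i ≠ λ_m is also proved when the listed λ_i are pairwise distinct. *)

(* Defs.v *)
From HB Require Import structures.
From mathcomp Require Import all_boot all_order all_algebra.
From mathcomp Require Import complex.
From mathcomp Require Import all_classical all_reals all_analysis.

Set Implicit Arguments.
Unset Strict Implicit.
Unset Printing Implicit Defensive.

Import Order.TTheory GRing.Theory Num.Theory.
Import numFieldNormedType.Exports.

Local Open Scope classical_set_scope.
Local Open Scope ring_scope.
Local Open Scope complex_scope.

Section SpectralSquareRoot.
Context {R : realType} {d : nat}.

Definition spd : set 'M[R]_d :=
  [set A | A^T = A /\ forall v : 'cV[R]_d, v != 0 -> 0 < (v^T *m A *m v) 0 0].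

Definition proj1d (p : 'cV[R]_d) : 'M[R]_d := p *m p^T.

(* [p p^T] is automatically symmetric; idempotence and rank one make it the
   orthogonal projection onto a line.  Eigenvalues may be repeated in [lam]. *)
Definition eigen_decomposition
    (A : 'M[R]_d) (lam : 'I_d -> R) (p : 'I_d -> 'cV[R]_d) : Prop :=
  [/\ forall i, 0 < lam i,
      forall i j, proj1d (p i) *m proj1d (p j) =
                  (if i == j then proj1d (p i) else 0),
      forall i, \rank (proj1d (p i)) = 1%N
    & A = \sum_i lam i *: proj1d (p i)].

(* The choice is immaterial: the sum below depends on [A] only. *)
Definition spd_sqrt (A : 'M[R]_d) : 'M[R]_d :=
  xget 0 [set S | exists lam p, eigen_decomposition A lam p /\
                  S = \sum_i Num.sqrt (lam i) *: proj1d (p i)].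

End SpectralSquareRoot.

Section ContourIntegrals.
Context {R : realType}.

Definition velocity (gamma : R -> R[i]) (t : R) : R[i] :=
  derive1 (fun s => complex.Re (gamma s)) t +i*
  derive1 (fun s => complex.Im (gamma s)) t.

(* A smooth closed curve is a 1-periodic, regular C^1 map on the real line. *)
Definition smooth_closed_curve (gamma : R -> R[i]) : Prop :=
  [/\ forall t, gamma (t + 1) = gamma t,
      forall t, derivable (fun s => complex.Re (gamma s)) t 1 /\
                derivable (fun s => complex.Im (gamma s)) t 1,
      continuous (derive1 (fun s => complex.Re (gamma s))) /\
      continuous (derive1 (fun s => complex.Im (gamma s)))
    & forall t, velocity gamma t != 0].

Definition integral01 (f : R -> R[i]) : R[i] :=
  (\int[lebesgue_measure]_(t in `[0, 1]) complex.Re (f t)) +i*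
  (\int[lebesgue_measure]_(t in `[0, 1]) complex.Im (f t)).

(* [Gamma] is a cycle: the union of finitely many closed curves. *)
Definition contour_integral n (Gamma : 'I_n -> R -> R[i]) (f : R[i] -> R[i])
    : R[i] :=
  \sum_(j < n) integral01 (fun t => f (Gamma j t) * velocity (Gamma j) t).

Definition two_pi_i : R[i] := 0 +i* (2 * pi).

Definition winding_number n (Gamma : 'I_n -> R -> R[i]) (w : R[i]) : R[i] :=
  two_pi_i^-1 * contour_integral Gamma (fun z => (z - w)^-1).

(* [R[i]^o] carries the usual topology of the complex plane.  The boundary of
   [Omega] is a finite union of disjoint simple smooth closed curves, and the
   usual (positive) orientation is expressed by the winding numbers. *)
Definition smooth_positive_boundary (Omega : set (R[i]^o))
    n (Gamma : 'I_n -> R -> R[i]) : Prop :=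
  [/\ forall j, smooth_closed_curve (Gamma j),
      forall j k s t, 0 <= s < 1 -> 0 <= t < 1 ->
        Gamma j s = Gamma k t -> j = k /\ s = t,
      closure Omega `\` Omega = [set z | exists j t, z = Gamma j t],
      forall w, Omega w -> winding_number Gamma w = 1
    & forall w, ~ closure Omega w -> winding_number Gamma w = 0].

Definition slit_plane : set (R[i]^o) :=
  [set z | ~ (complex.Im z = 0 /\ complex.Re z <= 0)].

Definition spectrum d (M : 'M[R[i]]_d) : set (R[i]^o) :=
  [set z | eigenvalue M z].

Definition sqrt_contour d (M : 'M[R[i]]_d) (Omega : set (R[i]^o))
    n (Gamma : 'I_n -> R -> R[i]) : Prop :=
  [/\ open Omega, bounded_set Omega, closure Omega `<=` slit_plane,
      smooth_positive_boundary Omega Gamma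
    & spectrum M `<=` Omega].

(* [sqrtc] is the principal branch on the slit plane (unlike
   [Num.sqrtC], whose cut is the positive half-line). *)
Definition contour_sqrt d n (Gamma : 'I_n -> R -> R[i]) (M : 'M[R[i]]_d)
    : 'M[R[i]]_d :=
  \matrix_(i, j) (two_pi_i^-1 * contour_integral Gamma
    (fun z => sqrtc z * invmx (z%:M - M) i j)).

End ContourIntegrals.

Section Phi.
Context {R : realType} {d : nat}.

Local Notation space := (('cV[R]_d * 'cV[R]_d) * ('M[R]_d * 'M[R]_d))%type.

Definition toC (A : 'M[R]_d) : 'M[R[i]]_d := map_mx (real_complex R) A.

(* The Euclidean inner product; the library norm on ['cV_d] is the sup norm. *)
Definition dot (u v : 'cV[R]_d) : R := (u^T *m v) 0 0.

Definition Phi (x : space) : R :=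
  let: ((mu, nu), (A, B)) := x in
  dot (mu - nu) (mu - nu) + \tr A + \tr B
  - 2 * \tr (spd_sqrt (spd_sqrt A *m B *m spd_sqrt A)).

(* [Gamma1] is used for the square roots of [A] and [Gamma2] for the outer
   square root.  For real arguments with spectra enclosed by the contours the
   trace below is a real number, since the principal branch commutes with
   complex conjugation; [complex.Re] only serves as the projection to [R]. *)
Definition Phi_ext n1 (Gamma1 : 'I_n1 -> R -> R[i])
    n2 (Gamma2 : 'I_n2 -> R -> R[i]) (x : space) : R :=
  let: ((mu, nu), (A, B)) := x in
  let S := contour_sqrt Gamma1 (toC A) in
  dot (mu - nu) (mu - nu) + \tr A + \tr B
  - 2 * complex.Re (\tr (contour_sqrt Gamma2 (S *m toC B *m S))).

Definition quad (q : 'cV[R]_d) (M : 'M[R]_d) : R := (q^T *m M *m q) 0 0.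

(* [off i m] selects the index pairs of the last double sum: [i != m], or
   [lam i != lam m] when [A] has simple spectrum.  If [lam] has repetitions, the
   latter would drop the cross terms inside the eigenspaces of [A], which are
   nonzero in general. *)
Definition dPhi (off : rel 'I_d) (mu nu : 'cV[R]_d) (A : 'M[R]_d)
    (lam : 'I_d -> R) (p : 'I_d -> 'cV[R]_d)
    (kap : 'I_d -> R) (q : 'I_d -> 'cV[R]_d) (h : space) : R :=
  let: ((g, g'), (G, G')) := h in
  2 * dot (mu - nu) (g - g') + \tr G + \tr G'
  - \sum_l Num.sqrt (kap l) *
      \sum_i (lam i)^-1 * quad (q l) (proj1d (p i) *m G *m proj1d (p i))
  - \sum_l (Num.sqrt (kap l))^-1 *
      quad (q l) (spd_sqrt A *m G' *m spd_sqrt A)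
  - \sum_l Num.sqrt (kap l) *
      \sum_i \sum_(m | off i m) (Num.sqrt (lam i * lam m))^-1 *
        quad (q l) (proj1d (p i) *m G *m proj1d (p m)).

End Phi.

(* Main.v *)
Require Import Defs.
From HB Require Import structures.
From mathcomp Require Import all_boot all_order all_algebra.
From mathcomp Require Import complex.
From mathcomp Require Import all_classical all_reals all_analysis.
From mathcomp Require Import ring lra.

(* For a real eigenvalue a = alpha ^+ 2 enclosed by the contour, every contour
   integral needed reduces to the winding number of a, because the integrands
   left over have explicit primitives along the curves: with u = sqrtc z,
   u / (z - a) = alpha / (z - a) + 1 / (u + alpha), where 1 / u and
   1 / (u (u + alpha)) are the derivatives of 2 u and 2 log (u + alpha), and the
   double pole is removed with the primitive u / (z - a).  No Cauchy theorem is
   needed.  Hence the contour root of M = sum_i alpha_i ^+ 2 P_i is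
   S = sum_i alpha_i P_i.  The second resolvent identity, with a bound for the
   perturbed resolvent that is uniform on the contour, gives
     root (M + H) = S + D H + O(H^2),
     D H = sum_(i, j) (alpha_i + alpha_j)^-1 P_i H P_j,
   and D H solves the Sylvester equation S X + X S = H.  For the outer root only
   the trace matters, and the trace kills the terms with i <> j.  Finally
   B S q_l = kap_l S^-1 q_l, and the Sylvester equation multiplied by S^-1 on
   both sides reads S^-1 X + X S^-1 = S^-1 G S^-1; expanding the right-hand side
   over the pairs of eigenprojections of A is the stated formula. *)

Import Order.TTheory GRing.Theory Num.Theory.
Import numFieldNormedType.Exports.
Import Normc.

Local Open Scope classical_set_scope.
Local Open Scope ring_scope.
Local Open Scope complex_scope.

(** * Complex-valued curves *)

Local Notation Re := complex.Re.
Local Notation Im := complex.Im.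

Section ComplexValuedCurves.
Context {R : realType}.
Implicit Types (f g : R -> R[i]) (c z w : R[i]).

(** The directions [G] and [G'] are arbitrary real matrices, so the perturbed arguments are in
    general neither symmetric nor diagonalizable. The expansion therefore uses the spectral
    resolution of the unperturbed matrices only, and controls the perturbed resolvent purely by norm
    estimates. Eigenvectors at perturbed points appear only when both perturbed arguments are again
    positive definite, to identify [Phi_ext] with [Phi]. The two nested roots are composed by
    counting orders of vanishing in [h]: inner root, product and outer root each get a first-order
    term plus an error of order two, and a quadratic error is converted into a Fréchet derivative
    once, at the very end. Every estimate rests on one radius [r]. A ball of radius [r] around each
    eigenvalue lies in the open set [Omega], while the contour avoids [Omega]; hence the contour
    keeps distance [r] from the spectrum, and a perturbed eigenvalue that stays within [r] is still
    enclosed. The same contours thus serve a whole neighbourhood. *)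

Definition ccont f :=
  continuous (fun t => Re (f t)) /\ continuous (fun t => Im (f t)).

(** Differentiation in a real variable, taken componentwise like [integral01], so that the
    fundamental theorem of calculus applies to each component. *)
Definition cderive f f' := forall t : R,
  is_derive t 1 (fun s => Re (f s)) (Re (f' t)) /\
  is_derive t 1 (fun s => Im (f s)) (Im (f' t)).

Lemma ReD z w : Re (z + w) = Re z + Re w.
Proof. by case: z w => [? ?] [? ?]. Qed.

Lemma ImD z w : Im (z + w) = Im z + Im w.
Proof. by case: z w => [? ?] [? ?]. Qed.

Lemma ReM z w : Re (z * w) = Re z * Re w - Im z * Im w.
Proof. by case: z w => [? ?] [? ?]. Qed.

Lemma ImM z w : Im (z * w) = Re z * Im w + Im z * Re w.
Proof. by case: z w => [? ?] [? ?]. Qed.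

Lemma ReV z : Re z^-1 = Re z / (Re z ^+ 2 + Im z ^+ 2).
Proof. by case: z. Qed.

Lemma ImV z : Im z^-1 = - (Im z / (Re z ^+ 2 + Im z ^+ 2)).
Proof. by case: z => a b /=; rewrite -mulNr. Qed.

Lemma complex_ext z w : Re z = Re w -> Im z = Im w -> z = w.
Proof. by case: z w => [? ?] [? ?] /= -> ->. Qed.

Lemma sqr_normc_gt0 z : z != 0 -> 0 < Re z ^+ 2 + Im z ^+ 2.
Proof.
move=> z0; rewrite lt_def addr_ge0 ?sqr_ge0// andbT.
apply: contra z0 => /eqP/(congr1 Num.sqrt); rewrite sqrtr0.
by case: z => a b /= h; apply/eqP; apply: eq0_normc.
Qed.

Lemma ccont_cst c : ccont (fun=> c).
Proof. by split=> t; exact: cvg_cst. Qed.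

Lemma ccontD f g : ccont f -> ccont g -> ccont (fun t => f t + g t).
Proof.
move=> [f1 f2] [g1 g2]; split=> t.
  by under eq_fun do rewrite ReD; apply: cvgD; [exact: f1|exact: g1].
by under eq_fun do rewrite ImD; apply: cvgD; [exact: f2|exact: g2].
Qed.

Lemma ccontM f g : ccont f -> ccont g -> ccont (fun t => f t * g t).
Proof.
move=> [f1 f2] [g1 g2]; split=> t.
  under eq_fun do rewrite ReM.
  by apply: cvgB; apply: cvgM; [exact: f1|exact: g1|exact: f2|exact: g2].
under eq_fun do rewrite ImM.
by apply: cvgD; apply: cvgM; [exact: f1|exact: g2|exact: f2|exact: g1].
Qed.

Lemma ccontN f : ccont f -> ccont (fun t => - f t).
Proof.
move=> /(ccontM _ _ (ccont_cst (-1))).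
by under eq_fun do rewrite mulN1r.
Qed.

Lemma ccontV f : ccont f -> (forall t, f t != 0) -> ccont (fun t => (f t)^-1).
Proof.
move=> [f1 f2] f0.
have n0 t : Re (f t) ^+ 2 + Im (f t) ^+ 2 != 0.
  by rewrite gt_eqF ?sqr_normc_gt0.
have cn : continuous (fun t => (Re (f t) ^+ 2 + Im (f t) ^+ 2)^-1).
  move=> t; apply: cvgV; first exact: n0.
  apply: cvgD; rewrite expr2; under eq_fun do rewrite expr2;
    by apply: cvgM; first [exact: f1|exact: f2].
split=> t.
  by under eq_fun do rewrite ReV; apply: cvgM; [exact: f1|exact: cn].
under eq_fun do rewrite ImV; apply: cvgN.
by apply: cvgM; [exact: f2|exact: cn].
Qed.

Lemma ccont_sum (I : Type) (r : seq I) (P : pred I) (F : I -> R -> R[i]) :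
  (forall i, ccont (F i)) -> ccont (fun t => \sum_(i <- r | P i) F i t).
Proof.
move=> cF; elim: r => [|i r ih].
  by under eq_fun do rewrite big_nil; exact: ccont_cst.
under eq_fun do rewrite big_cons.
by case: (P i) => //; apply: ccontD.
Qed.

Lemma ccont_prod (I : Type) (r : seq I) (P : pred I) (F : I -> R -> R[i]) :
  (forall i, ccont (F i)) -> ccont (fun t => \prod_(i <- r | P i) F i t).
Proof.
move=> cF; elim: r => [|i r ih].
  by under eq_fun do rewrite big_nil; exact: ccont_cst.
under eq_fun do rewrite big_cons.
by case: (P i) => //; apply: ccontM.
Qed.

Lemma ccont_det n (M : R -> 'M[R[i]]_n) :
  (forall i j, ccont (fun t => M t i j)) -> ccont (fun t => \det (M t)).
Proof.
move=> cM; apply: ccont_sum => s; apply: ccontM; first exact: ccont_cst.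
by apply: ccont_prod => i.
Qed.

(** Cramer's rule: an entry of the inverse is a cofactor over the determinant, both polynomial in
    the entries. *)
Lemma ccont_invmx n (M : R -> 'M[R[i]]_n) i j :
  (forall i j, ccont (fun t => M t i j)) -> (forall t, M t \in unitmx) ->
  ccont (fun t => invmx (M t) i j).
Proof.
move=> cM uM.
have -> : (fun t => invmx (M t) i j) =
    (fun t => (\det (M t))^-1 * cofactor (M t) j i).
  by apply/funext => t; rewrite /invmx uM !mxE.
apply: ccontM.
  apply: ccontV; first exact: ccont_det.
  by move=> t; have := uM t; rewrite unitmxE unitfE.
apply: ccontM; first exact: ccont_cst.
apply: ccont_det => k l.
by under eq_fun do rewrite !mxE; exact: cM.
Qed.

Lemma is_derive1M (u v : R -> R) (t a b : R) :
  is_derive t 1 u a -> is_derive t 1 v b ->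
  is_derive t 1 (fun s => u s * v s) (a * v t + u t * b).
Proof.
move=> du dv; rewrite addrC [a * _]mulrC.
exact: (is_deriveM (f := u) (g := v)).
Qed.

Lemma is_derive1V (u : R -> R) (t a : R) : u t != 0 ->
  is_derive t 1 u a -> is_derive t 1 (fun s => (u s)^-1) (- a / u t ^+ 2).
Proof.
move=> u0 [du <-]; split; first exact: derivableV.
by rewrite deriveV// /GRing.scale/= mulNr mulrC mulNr.
Qed.

Lemma cderive_cst c : cderive (fun=> c) (fun=> 0).
Proof. by move=> t; split; exact: is_derive_cst. Qed.

Lemma cderiveD f f' g g' : cderive f f' -> cderive g g' ->
  cderive (fun t => f t + g t) (fun t => f' t + g' t).
Proof.
move=> df dg t; have [f1 f2] := df t; have [g1 g2] := dg t; split.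
  by under eq_fun do rewrite ReD; rewrite ReD; exact: is_deriveD.
by under eq_fun do rewrite ImD; rewrite ImD; exact: is_deriveD.
Qed.

Lemma cderiveM f f' g g' : cderive f f' -> cderive g g' ->
  cderive (fun t => f t * g t) (fun t => f' t * g t + f t * g' t).
Proof.
move=> df dg t; have [f1 f2] := df t; have [g1 g2] := dg t; split.
  under eq_fun do rewrite ReM.
  apply: is_derive_eq.
  by rewrite ReD !ReM /GRing.scale/=; ring.
under eq_fun do rewrite ImM.
apply: is_derive_eq.
by rewrite ImD !ImM /GRing.scale/=; ring.
Qed.

Lemma cderiveZ c f f' : cderive f f' ->
  cderive (fun t => c * f t) (fun t => c * f' t).
Proof.
move=> df t; have := cderiveM _ _ _ _ (cderive_cst c) df t.
by rewrite mul0r add0r.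
Qed.

Lemma cderive_eq f f' g' : cderive f f' -> f' =1 g' -> cderive f g'.
Proof. by move=> df /funext <-. Qed.

Lemma cderive_ccont f f' : cderive f f' -> ccont f.
Proof.
move=> df; split=> t; apply: differentiable_continuous; apply/derivable1_diffP.
  by have [[]] := df t.
by have [_ []] := df t.
Qed.

Lemma cderiveV f f' : cderive f f' -> (forall t, f t != 0) ->
  cderive (fun t => (f t)^-1) (fun t => - f' t / f t ^+ 2).
Proof.
move=> df f0 t; have [f1 f2] := df t.
have n0 : Re (f t) ^+ 2 + Im (f t) ^+ 2 != 0 by rewrite gt_eqF ?sqr_normc_gt0.
have dn : is_derive t 1 (fun s => (Re (f s) ^+ 2 + Im (f s) ^+ 2)^-1)
   (- (2 * (Re (f t) * Re (f' t) + Im (f t) * Im (f' t)))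
     / (Re (f t) ^+ 2 + Im (f t) ^+ 2) ^+ 2).
  apply: is_derive1V => //.
  under eq_fun do rewrite !expr2.
  apply: is_derive_eq.
  by rewrite /GRing.scale/=; ring.
have n02 : (Re (f t) * Re (f t) - Im (f t) * Im (f t)) ^+ 2 +
     (Re (f t) * Im (f t) + Im (f t) * Re (f t)) ^+ 2 != 0.
  rewrite [X in X != 0](_ : _ = (Re (f t) ^+ 2 + Im (f t) ^+ 2) ^+ 2); last ring.
  by rewrite expf_eq0.
split.
  under eq_fun do rewrite ReV; apply: is_derive_eq.
  rewrite expr2 ReM ReV ImV !ReM !ImM /GRing.scale/=.
  have -> : Re (- f' t) = - Re (f' t) by case: (f' t).
  have -> : Im (- f' t) = - Im (f' t) by case: (f' t).
  by field; rewrite n0 n02.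
under eq_fun do rewrite ImV; apply: is_derive_eq.
rewrite expr2 ImM ReV ImV !ReM !ImM /GRing.scale/=.
have -> : Re (- f' t) = - Re (f' t) by case: (f' t).
have -> : Im (- f' t) = - Im (f' t) by case: (f' t).
by field; rewrite n0 n02.
Qed.

Lemma integrable01 (f : R -> R) : continuous f ->
  (@lebesgue_measure R).-integrable `[0, 1] (EFin \o f).
Proof.
move=> cf; apply: continuous_compact_integrable; first exact: segment_compact.
by apply: continuous_subspaceT => x; exact: cf.
Qed.

Lemma integral01D f g : ccont f -> ccont g ->
  integral01 (fun t => f t + g t) = integral01 f + integral01 g.
Proof.
move=> [f1 f2] [g1 g2]; rewrite /integral01.
under eq_Rintegral do rewrite ReD; under [in X in _ +i* X]eq_Rintegral do rewrite ImD.
by rewrite !RintegralD//; exact: integrable01.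
Qed.

Lemma integral01Z c f : ccont f ->
  integral01 (fun t => c * f t) = c * integral01 f.
Proof.
move=> [f1 f2]; rewrite /integral01.
have cM (a : R) (h : R -> R) : continuous h -> continuous (fun t => a * h t).
  by move=> ch t; apply: cvgM; [exact: cvg_cst|exact: ch].
under eq_Rintegral do rewrite ReM.
under [in X in _ +i* X]eq_Rintegral do rewrite ImM.
rewrite RintegralB ?RintegralD//; try (apply: integrable01; exact: cM).
by rewrite !RintegralZl//; try exact: integrable01; apply: complex_ext;
   rewrite ?ReM ?ImM.
Qed.

Lemma Rintegral01_deriv (F f : R -> R) : continuous f ->
  (forall t : R, is_derive t 1 F (f t)) ->
  \int[lebesgue_measure]_(t in `[0, 1]) f t = F 1 - F 0.
Proof.
move=> cf dF; rewrite /Rintegral (continuous_FTC2 (F := F))//.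
- by apply: continuous_subspaceT => x; exact: cf.
- have cF : continuous F.
    move=> t; apply: differentiable_continuous; apply/derivable1_diffP.
    by have [] := dF t.
  split=> //.
  + by apply: cvg_at_right_filter; exact: cF.
  + by apply: cvg_at_left_filter; exact: cF.
- by move=> t _; rewrite derive1E; have [_ ->] := dF t.
Qed.

Lemma integral01_deriv F f : ccont f -> cderive F f ->
  integral01 f = F 1 - F 0.
Proof.
move=> [f1 f2] dF; rewrite /integral01.
rewrite (Rintegral01_deriv _ _ f1 (fun t => proj1 (dF t))).
rewrite (Rintegral01_deriv _ _ f2 (fun t => proj2 (dF t))).
by case: (F 1) (F 0) => [? ?] [? ?].
Qed.

Lemma normr_Re_le z : `|Re z| <= normc z.
Proof.
by case: z => a b /=; rewrite -sqrtr_sqr ler_wsqrtr// lerDl sqr_ge0.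
Qed.

Lemma normr_Im_le z : `|Im z| <= normc z.
Proof.
by case: z => a b /=; rewrite -sqrtr_sqr ler_wsqrtr// lerDr sqr_ge0.
Qed.

Lemma normc_ge0 z : 0 <= normc z.
Proof. by case: z => a b; exact: sqrtr_ge0. Qed.

Lemma normcD_le z w : normc (z + w) <= normc z + normc w.
Proof. exact: (@le_normcD R z w). Qed.

Lemma normc_opp z : normc (- z) = normc z.
Proof. exact: (@normcN R z). Qed.

Lemma normc_real (x : R) : normc x%:C = `|x|.
Proof. by rewrite /= expr0n addr0 sqrtr_sqr. Qed.

Lemma normc_le_ReIm z : normc z <= `|Re z| + `|Im z|.
Proof.
case: z => a b /=; rewrite -[leRHS]ger0_norm ?addr_ge0// -sqrtr_sqr.
rewrite ler_wsqrtr// sqrrD !real_normK ?num_real//.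
by rewrite -addrA lerD2l lerDr mulrn_wge0 ?mulr_ge0.
Qed.

Lemma Rintegral01_bound (f : R -> R) (m : R) : continuous f ->
  (forall t, 0 <= t <= 1 -> `|f t| <= m) ->
  `|\int[lebesgue_measure]_(t in `[0, 1]) f t| <= m.
Proof.
move=> cf fm; apply: (le_trans (le_normr_Rintegral _ _)) => //.
  exact: integrable01.
have <- : \int[@lebesgue_measure R]_(t in `[0, 1]) m = m.
  by rewrite Rintegral_cst// /= lebesgue_measure_itv/= lte_fin ltr01 oppr0 addr0 mulr1.
apply: le_Rintegral => //.
- by apply: integrable01 => t; apply: cvg_norm; exact: cf.
- by apply: integrable01 => t; exact: cvg_cst.
Qed.

(** The factor 2 comes from estimating the real and imaginary parts separately; only the order of
    the bound matters later. *)
Lemma integral01_bound f (m : R) : ccont f ->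
  (forall t, 0 <= t <= 1 -> normc (f t) <= m) -> normc (integral01 f) <= 2 * m.
Proof.
move=> [f1 f2] fm; apply: (le_trans (normc_le_ReIm _)).
rewrite mulr_natl mulr2n; apply: lerD; apply: Rintegral01_bound => // t /fm.
  exact/le_trans/normr_Re_le.
exact/le_trans/normr_Im_le.
Qed.

Lemma ccont_bounded f : ccont f ->
  exists2 m, 0 < m & forall t, 0 <= t <= 1 -> normc (f t) <= m.
Proof.
move=> [f1 f2].
have cf : continuous (fun t => `|Re (f t)| + `|Im (f t)|).
  by move=> t; apply: cvgD; apply: cvg_norm; [exact: f1|exact: f2].
have [c _ hc] := EVT_max ler01 (continuous_subspaceT cf).
exists (`|Re (f c)| + `|Im (f c)| + 1).
  by rewrite ltr_wpDl ?addr_ge0.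
move=> t t01; apply: (le_trans (normc_le_ReIm _)).
by apply: (le_trans (hc t _)); rewrite ?in_itv//= lerDl.
Qed.

End ComplexValuedCurves.

(** * Square root, logarithm and contour integrals *)

Section ComplexFunctionsAlongCurves.
Context {R : realType}.
Implicit Types (f g : R -> R[i]) (z : R[i]).

Lemma cderive_unique f f1 f2 : cderive f f1 -> cderive f f2 -> f1 =1 f2.
Proof.
move=> d1 d2 t; have [[_ r1] [_ i1]] := d1 t; have [[_ r2] [_ i2]] := d2 t.
by apply: complex_ext; [rewrite -r1 -r2|rewrite -i1 -i2].
Qed.

(** The quantity is twice the square of the real part of the principal root, so off the cut that
    real part is the root of a positive number and depends differentiably on [z]. *)
Lemma slit_plane_abs_gt z : slit_plane z ->
  0 < Num.sqrt (Re z ^+ 2 + Im z ^+ 2) + Re z.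
Proof.
move=> zs; rewrite -ltrBlDr sub0r.
have [b0|b0] := eqVneq (Im z) 0.
  have a0 : 0 < Re z by rewrite ltNge; apply/negP => a0; apply: zs.
  by apply: (@lt_le_trans _ _ 0); rewrite ?oppr_lt0// sqrtr_ge0.
apply: (le_lt_trans (ler_norm _)); rewrite normrN -sqrtr_sqr ltr_sqrt.
  by rewrite ltrDl lt_def sqr_ge0 sqrf_eq0 b0.
by rewrite ltr_wpDl ?sqr_ge0// lt_def sqr_ge0 sqrf_eq0 b0.
Qed.

Lemma Re_sqrtcE z :
  Re (sqrtc z) = Num.sqrt ((Num.sqrt (Re z ^+ 2 + Im z ^+ 2) + Re z) / 2).
Proof. by case: z. Qed.

Lemma Re_sqrtc_gt0 z : slit_plane z -> 0 < Re (sqrtc z).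
Proof.
by move=> /slit_plane_abs_gt zs; rewrite Re_sqrtcE sqrtr_gt0 divr_gt0.
Qed.

(** Read off from the imaginary part of [sqrtc z ^+ 2 = z]; this form replaces the case distinction
    on the sign of [Im z] by a differentiable quotient. *)
Lemma Im_sqrtcE z : slit_plane z ->
  Im (sqrtc z) = Im z / (2 * Re (sqrtc z)).
Proof.
move=> zs; have s0 := Re_sqrtc_gt0 _ zs.
have := congr1 (@complex.Im R) (sqr_sqrtc z); rewrite expr2 ImM => <-.
by field; rewrite gt_eqF.
Qed.

Lemma is_derive1_chain (h u : R -> R) (t a b : R) :
  is_derive (u t) 1 h a -> is_derive t 1 u b ->
  is_derive t 1 (fun s => h (u s)) (a * b).
Proof. exact: (is_derive1_comp (f := h) (g := u)). Qed.

Lemma derivable_sqrt_comp (u : R -> R) (t : R) : 0 < u t ->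
  derivable u t 1 -> derivable (fun s => Num.sqrt (u s)) t 1.
Proof.
move=> u0 /derivableP du.
by have [] := is_derive1_chain _ _ _ _ _ (is_derive1_sqrt u0) du.
Qed.

Lemma derivable1M (u v : R -> R) (t : R) :
  derivable u t 1 -> derivable v t 1 -> derivable (fun s => u s * v s) t 1.
Proof. exact: derivableM. Qed.

(** The real formulas yield only that some derivative exists. Its value then follows by
    differentiating the square of the root, which is [g], and comparing through uniqueness of
    derivatives. *)
Lemma cderive_sqrtc g g' : cderive g g' -> (forall t, slit_plane (g t)) ->
  cderive (fun t => sqrtc (g t)) (fun t => g' t / (2 * sqrtc (g t))).
Proof.
move=> dg gs.
have [u' du] : exists u', cderive (fun t => sqrtc (g t)) u'.
  suff h (t : R) : exists w : R[i],
      is_derive t 1 (fun s => Re (sqrtc (g s))) (Re w) /\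
      is_derive t 1 (fun s => Im (sqrtc (g s))) (Im w).
    by exists (fun t => projT1 (cid (h t))) => t; exact: projT2 (cid (h t)).
  have [dr di] := dg t.
  have n0 : 0 < Re (g t) ^+ 2 + Im (g t) ^+ 2.
    apply: sqr_normc_gt0; apply/negP => /eqP g0.
    by apply: (gs t); rewrite g0.
  have dn : derivable (fun s => Num.sqrt (Re (g s) ^+ 2 + Im (g s) ^+ 2)) t 1.
    by apply: derivable_sqrt_comp => //; apply: ex_derive.
  have dRe : derivable (fun s => Re (sqrtc (g s))) t 1.
    under eq_fun do rewrite Re_sqrtcE.
    apply: derivable_sqrt_comp.
      by rewrite mulr_gt0//; apply: slit_plane_abs_gt.
    have ds := derivableD dn (@ex_derive _ _ _ _ _ _ _ dr).
    exact: (derivable1M _ (fun=> 2^-1) _ ds (derivable_cst _ _ _)).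
  have dIm : derivable (fun s => Im (sqrtc (g s))) t 1.
    have -> : (fun s => Im (sqrtc (g s))) =
        (fun s => Im (g s) * (2 * Re (sqrtc (g s)))^-1).
      by apply/funext => s /=; rewrite Im_sqrtcE.
    have n2 : 2 * Re (sqrtc (g t)) != 0.
      by rewrite gt_eqF// mulr_gt0// Re_sqrtc_gt0.
    have d2 := derivable1M (fun=> 2) _ _ (derivable_cst _ _ _) dRe.
    have [dV _] := is_derive1V (fun s => 2 * Re (sqrtc (g s))) _ _ n2
      (derivableP d2).
    exact: (derivable1M (fun s => Im (g s)) _ _ (@ex_derive _ _ _ _ _ _ _ di) dV).
  exists (('D_1 (fun s => Re (sqrtc (g s))) t) +i*
          ('D_1 (fun s => Im (sqrtc (g s))) t)).
  by split; [exact: (derivableP dRe)|exact: (derivableP dIm)].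
have u0 t : sqrtc (g t) != 0.
  by apply/eqP => /(congr1 (@complex.Re R))/eqP; rewrite gt_eqF// Re_sqrtc_gt0.
have duu := cderiveM _ _ _ _ du du.
have dgg : cderive (fun t => sqrtc (g t) * sqrtc (g t)) g'.
  have -> // : (fun t => sqrtc (g t) * sqrtc (g t)) = g.
  by apply/funext => t; rewrite -expr2 sqr_sqrtc.
apply: (cderive_eq _ _ _ du) => t.
by rewrite -(cderive_unique _ _ _ duu dgg t); field; exact: u0.
Qed.

(** The principal logarithm on the right half-plane, where the argument is the arctangent of a
    slope. It is applied to [sqrtc z + a], whose real part is positive. *)
Definition clog z : R[i] :=
  (ln (Re z ^+ 2 + Im z ^+ 2) / 2) +i* atan (Im z / Re z).

Lemma cderive_clog g g' : cderive g g' -> (forall t, 0 < Re (g t)) ->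
  cderive (fun t => clog (g t)) (fun t => g' t / g t).
Proof.
move=> dg g0 t; have [dr di] := dg t; have a0 := g0 t.
have n0 : 0 < Re (g t) ^+ 2 + Im (g t) ^+ 2.
  by rewrite ltr_pwDl ?exprn_gt0 ?sqr_ge0.
split.
  have d2 : is_derive t 1 (fun s => Re (g s) ^+ 2 + Im (g s) ^+ 2)
      (2 * (Re (g t) * Re (g' t) + Im (g t) * Im (g' t))).
    by apply: is_derive_eq; rewrite /GRing.scale/=; ring.
  have dl := is_derive1_chain _
    (fun s => Re (g s) ^+ 2 + Im (g s) ^+ 2) _ _ _ (is_derive1_ln n0) d2.
  have dh := is_derive1M (fun s => ln (Re (g s) ^+ 2 + Im (g s) ^+ 2))
    (fun=> 2^-1) _ _ _ dl (is_derive_cst (2^-1 : R) t 1).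
  refine (is_derive_eq dh _).
  rewrite ReM ReV ImV /=; field.
  by rewrite gt_eqF.
have dv : is_derive t 1 (fun s => (Re (g s))^-1) (- Re (g' t) / Re (g t) ^+ 2).
  by apply: is_derive1V => //; rewrite gt_eqF.
have dq := is_derive1M _ _ _ _ _ di dv.
have da := (is_derive1_chain _ (fun s => Im (g s) * (Re (g s))^-1) _ _ _
    (is_derive1_atan _) dq).
refine (is_derive_eq da _).
rewrite ImM ReV ImV /=; field.
by apply/andP; split; rewrite gt_eqF.
Qed.

End ComplexFunctionsAlongCurves.

(** * Linearity, primitives and bounds for contour integrals *)

Section ContourIntegralCalculus.
Context {R : realType} {n : nat} (Gamma : 'I_n -> R -> R[i]).
Context (smooth : forall j, smooth_closed_curve (Gamma j)).
Implicit Types (f g F : R[i] -> R[i]) (z : R[i]).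

Definition ccont_on f := forall j, ccont (fun t => f (Gamma j t)).

Lemma cderive_curve j : cderive (Gamma j) (velocity (Gamma j)).
Proof.
move=> t; have [_ /(_ t)[dr di] _ _] := smooth j.
by split=> /=; rewrite derive1E; exact: derivableP.
Qed.

Lemma ccont_velocity j : ccont (velocity (Gamma j)).
Proof. by have [_ _ [cr ci] _] := smooth j; split; [exact: cr|exact: ci]. Qed.

Lemma ccont_curve j : ccont (Gamma j).
Proof. exact: cderive_ccont (cderive_curve j). Qed.

Lemma eq_contour_integral f g : (forall j t, f (Gamma j t) = g (Gamma j t)) ->
  contour_integral Gamma f = contour_integral Gamma g.
Proof.
move=> fg; apply: eq_bigr => j _; congr integral01; apply/funext => t.
by rewrite fg.
Qed.

Lemma contour_integralD f g : ccont_on f -> ccont_on g ->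
  contour_integral Gamma (fun z => f z + g z) =
  contour_integral Gamma f + contour_integral Gamma g.
Proof.
move=> cf cg; rewrite /contour_integral -big_split/=; apply: eq_bigr => j _.
rewrite -integral01D; last 2 first.
- by apply: ccontM; [exact: cf|exact: ccont_velocity].
- by apply: ccontM; [exact: cg|exact: ccont_velocity].
by congr integral01; apply/funext => t; rewrite mulrDl.
Qed.

Lemma contour_integralZ c f : ccont_on f ->
  contour_integral Gamma (fun z => c * f z) = c * contour_integral Gamma f.
Proof.
move=> cf; rewrite /contour_integral mulr_sumr; apply: eq_bigr => j _.
rewrite -integral01Z; last by apply: ccontM; [exact: cf|exact: ccont_velocity].
by congr integral01; apply/funext => t; rewrite mulrA.
Qed.

Lemma contour_integral0 : contour_integral Gamma (fun=> 0) = 0.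
Proof.
rewrite -[RHS](mul0r (contour_integral Gamma (fun=> 0))).
rewrite -contour_integralZ; last by move=> j; exact: ccont_cst.
by apply: eq_contour_integral => j t; rewrite mul0r.
Qed.

Lemma contour_integral_sum (I : Type) (r : seq I) (P : pred I)
    (F : I -> R[i] -> R[i]) : (forall i, ccont_on (F i)) ->
  contour_integral Gamma (fun z => \sum_(i <- r | P i) F i z) =
  \sum_(i <- r | P i) contour_integral Gamma (F i).
Proof.
move=> cF; elim: r => [|i r ih].
  rewrite big_nil -[RHS]contour_integral0.
  by apply: eq_contour_integral => j t; rewrite big_nil.
rewrite big_cons; case: ifPn => Pi; last first.
  rewrite -ih; apply: eq_contour_integral => j t.
  by rewrite big_cons (negbTE Pi).
rewrite -ih -contour_integralD//; last by move=> j; apply: ccont_sum => k; exact: cF.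
by apply: eq_contour_integral => j t; rewrite big_cons Pi.
Qed.

(** [F] is differentiated along the curves only, and its increment over a period is zero because
    each curve is 1-periodic. *)
Lemma contour_integral_primitive F f : ccont_on f ->
  (forall j, cderive (fun t => F (Gamma j t))
               (fun t => f (Gamma j t) * velocity (Gamma j) t)) ->
  contour_integral Gamma f = 0.
Proof.
move=> cf dF; rewrite /contour_integral big1// => j _.
rewrite (integral01_deriv _ _ _ (dF j)).
  have [+ _ _ _] := smooth j => /(_ 0); rewrite add0r => ->.
  by rewrite subrr.
by apply: ccontM; [exact: cf|exact: ccont_velocity].
Qed.

(** [K] depends on the weight [g] alone. This uniformity in [f] is essential: [g] will be the square
    root and [f] a remainder that varies with the perturbation. *)
Lemma contour_integral_bound g : ccont_on g -> exists2 K, 0 < K &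
  forall f m, ccont_on f -> 0 <= m ->
    (forall j t, normc (f (Gamma j t)) <= m) ->
  normc (contour_integral Gamma (fun z => g z * f z)) <= K * m.
Proof.
move=> cg.
have cgv j : ccont (fun t => g (Gamma j t) * velocity (Gamma j) t).
  by apply: ccontM; [exact: cg|exact: ccont_velocity].
pose M j := projT1 (cid2 (ccont_bounded _ (cgv j))).
have M0 j : 0 < M j by rewrite /M; case: cid2.
have gM j t : 0 <= t <= 1 ->
    normc (g (Gamma j t) * velocity (Gamma j) t) <= M j.
  by rewrite /M; case: cid2 => m /= _; exact.
(* The 2 is that of [integral01_bound]; the 1 keeps the constant positive when there are no
   curves. *)
exists (\sum_j 2 * M j + 1).
  by rewrite ltr_wpDl ?sumr_ge0// => j _; rewrite mulr_ge0 ?ltW.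
move=> f m cf m0 fm.
apply: (@le_trans _ _ (\sum_j 2 * (M j * m))); last first.
  rewrite mulrDl mul1r mulr_suml -[leLHS]addr0 lerD//.
  by apply: ler_sum => j _; rewrite mulrA.
rewrite /contour_integral; elim/big_ind2: _ => [|x1 x2 y1 y2 h1 h2|j _].
- by rewrite normc0.
- by apply: (le_trans (normcD_le _ _)); exact: lerD.
apply: integral01_bound => [|t t01].
  apply: ccontM; last exact: ccont_velocity.
  by apply: ccontM; [exact: cg|exact: cf].
by rewrite mulrAC normcM ler_pM ?normc_ge0// gM.
Qed.

End ContourIntegralCalculus.

(** * Square root against one or two resolvent factors *)

Section SquareRootContourIntegrals.
Context {R : realType} {n : nat} (Gamma : 'I_n -> R -> R[i]).
Context (smooth : forall j, smooth_closed_curve (Gamma j)).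
Context (slit : forall j t, slit_plane (Gamma j t)).
Implicit Types (a b z : R[i]).

Lemma sqrtc_neq0 z : slit_plane z -> sqrtc z != 0.
Proof.
move=> /Re_sqrtc_gt0 z0; apply/eqP => /(congr1 (@complex.Re R))/eqP.
by rewrite gt_eqF.
Qed.

Lemma addc_neq0 a b : 0 < Re a -> 0 < Re b -> a + b != 0.
Proof.
move=> a0 b0; apply/eqP => /(congr1 (@complex.Re R))/eqP.
by rewrite ReD gt_eqF ?addr_gt0.
Qed.

Lemma cderive_sqrtc_curve j : cderive (fun t => sqrtc (Gamma j t))
  (fun t => velocity (Gamma j) t / (2 * sqrtc (Gamma j t))).
Proof. by apply: cderive_sqrtc; [exact: cderive_curve|exact: slit]. Qed.

Lemma ccont_on_sqrtc : ccont_on Gamma (@sqrtc R).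
Proof. by move=> j; exact: cderive_ccont (cderive_sqrtc_curve j). Qed.

Lemma ccont_on_sqrtcV : ccont_on Gamma (fun z => (sqrtc z)^-1).
Proof.
by move=> j; apply: ccontV => [|t]; [exact: ccont_on_sqrtc|exact: sqrtc_neq0].
Qed.

Lemma ccont_on_sqrtcDV a : 0 < Re a ->
  ccont_on Gamma (fun z => (sqrtc z)^-1 * (sqrtc z + a)^-1).
Proof.
move=> a0 j; apply: ccontM; first exact: ccont_on_sqrtcV.
apply: ccontV => [|t]; last by rewrite addc_neq0// Re_sqrtc_gt0.
by apply: ccontD; [exact: ccont_on_sqrtc|exact: ccont_cst].
Qed.

Lemma ccont_on_subV a : (forall j t, Gamma j t != a) ->
  ccont_on Gamma (fun z => (z - a)^-1).
Proof.
move=> aG j; apply: ccontV => [|t]; last by rewrite subr_eq0.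
by apply: ccontD; [exact: ccont_curve|exact: ccont_cst].
Qed.

Lemma contour_integral_sqrtcV :
  contour_integral Gamma (fun z => (sqrtc z)^-1) = 0.
Proof.
apply: (contour_integral_primitive _ smooth (fun z => 2 * sqrtc z)).
  exact: ccont_on_sqrtcV.
move=> j; apply: cderive_eq; first exact: cderiveZ (cderive_sqrtc_curve j).
by move=> t /=; field; exact: sqrtc_neq0.
Qed.

Lemma contour_integral_sqrtcDV a : 0 < Re a ->
  contour_integral Gamma (fun z => (sqrtc z)^-1 * (sqrtc z + a)^-1) = 0.
Proof.
move=> a0.
apply: (contour_integral_primitive _ smooth (fun z => 2 * clog (sqrtc z + a))).
  exact: ccont_on_sqrtcDV.
move=> j; have dua := cderiveD _ _ _ _ (cderive_sqrtc_curve j) (cderive_cst a).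
apply: cderive_eq.
  apply: cderiveZ; apply: cderive_clog; first exact: dua.
  by move=> t; rewrite ReD addr_gt0// Re_sqrtc_gt0.
move=> t /=; field.
by rewrite sqrtc_neq0// addc_neq0// Re_sqrtc_gt0.
Qed.

Lemma contour_integral_sqrtc_resolvent a : 0 < Re a ->
  (forall j t, Gamma j t != a ^+ 2) ->
  contour_integral Gamma (fun z => sqrtc z * (z - a ^+ 2)^-1) =
  a * contour_integral Gamma (fun z => (z - a ^+ 2)^-1).
Proof.
move=> a0 aG.
have c1 := ccont_on_subV _ aG; have c2 := ccont_on_sqrtcV.
have c3 := ccont_on_sqrtcDV _ a0.
have cZ (c : R[i]) f : ccont_on Gamma f -> ccont_on Gamma (fun z => c * f z).
  by move=> cf j; apply: ccontM; [exact: ccont_cst|exact: cf].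
(* With [u = sqrtc z], the regular part [1 / (u + a)] is written [1 / u - a / (u (u + a))], since
   these two terms have the primitives at hand. *)
transitivity (contour_integral Gamma (fun z => a * (z - a ^+ 2)^-1 +
    ((sqrtc z)^-1 + - a * ((sqrtc z)^-1 * (sqrtc z + a)^-1)))).
  apply: eq_contour_integral => j t.
  set u := sqrtc _; have -> : Gamma j t = u ^+ 2 by rewrite sqr_sqrtc.
  have u0 : u != 0 by exact: sqrtc_neq0.
  have ua0 : u + a != 0 by rewrite addc_neq0// Re_sqrtc_gt0.
  have : u ^+ 2 - a ^+ 2 != 0 by rewrite sqr_sqrtc subr_eq0.
  by move=> h; field; rewrite h u0 ua0.
rewrite (contour_integralD _ smooth); last 2 first.
- exact: cZ.
- by move=> j; apply: ccontD; [exact: c2|exact: (cZ (- a) _ c3)].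
rewrite (contour_integralD _ smooth); [|exact: c2|exact: (cZ (- a) _ c3)].
rewrite !(contour_integralZ _ smooth)//.
by rewrite contour_integral_sqrtcV contour_integral_sqrtcDV// mulr0 !addr0.
Qed.

Lemma contour_integral_sqrtc_resolvent2 a : 0 < Re a ->
  (forall j t, Gamma j t != a ^+ 2) ->
  contour_integral Gamma
    (fun z => sqrtc z * ((z - a ^+ 2)^-1 * (z - a ^+ 2)^-1)) =
  (2 * a)^-1 * contour_integral Gamma (fun z => (z - a ^+ 2)^-1).
Proof.
move=> a0 aG.
have an0 : a != 0.
  by apply/eqP => a00; move: a0; rewrite a00 ltxx.
have c1 := ccont_on_subV _ aG; have c2 := ccont_on_sqrtcV.
have c3 := ccont_on_sqrtcDV _ a0.
have cZ (c : R[i]) f : ccont_on Gamma f -> ccont_on Gamma (fun z => c * f z).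
  by move=> cf j; apply: ccontM; [exact: ccont_cst|exact: cf].
(* [D] is the derivative of [sqrtc z / (z - a ^+ 2)], so it integrates to zero and trades the double
   pole for a simple one. *)
pose D z := 2^-1 * ((sqrtc z)^-1 * (z - a ^+ 2)^-1) -
   sqrtc z * ((z - a ^+ 2)^-1 * (z - a ^+ 2)^-1).
have cs : ccont_on Gamma
    (fun z => sqrtc z * ((z - a ^+ 2)^-1 * (z - a ^+ 2)^-1)).
  move=> j; apply: ccontM; first exact: ccont_on_sqrtc.
  by apply: ccontM; exact: c1.
have cD : ccont_on Gamma D.
  move=> j; apply: ccontD; last by apply: ccontN; exact: cs.
  by apply: ccontM; [exact: ccont_cst|apply: ccontM; [exact: c2|exact: c1]].
have D0 : contour_integral Gamma D = 0.
  apply: (contour_integral_primitive _ smooth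
    (fun z => sqrtc z * (z - a ^+ 2)^-1)) => // j.
  apply: cderive_eq.
    apply: cderiveM; first exact: cderive_sqrtc_curve.
    apply: cderiveV => [|t]; last by rewrite subr_eq0.
    by apply: cderiveD; [exact: cderive_curve|exact: cderive_cst].
  move=> t /=; rewrite /D; field.
  by rewrite subr_eq0 aG sqrtc_neq0.
rewrite -[RHS]subr0 -D0.
have h z : sqrtc z * ((z - a ^+ 2)^-1 * (z - a ^+ 2)^-1) =
  2^-1 * ((sqrtc z)^-1 * (z - a ^+ 2)^-1) + -1 * D z.
  by rewrite /D; ring.
(* The remaining [1 / (2 u (u^2 - a^2))] equals [1 / (2 a)] times the difference of
   [1 / (u^2 - a^2)] and [1 / (u (u + a))]. *)
transitivity (contour_integral Gamma (fun z => (2 * a)^-1 * (z - a ^+ 2)^-1 +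
   ((- (2 * a)^-1) * ((sqrtc z)^-1 * (sqrtc z + a)^-1) + -1 * D z))).
  apply: eq_contour_integral => j t; rewrite h addrA; congr (_ + _).
  set u := sqrtc _; have -> : Gamma j t = u ^+ 2 by rewrite sqr_sqrtc.
  have u0 : u != 0 by exact: sqrtc_neq0.
  have ua0 : u + a != 0 by rewrite addc_neq0// Re_sqrtc_gt0.
  have uan : u ^+ 2 - a ^+ 2 != 0 by rewrite sqr_sqrtc subr_eq0.
  by field; rewrite an0 uan u0 ua0.
have c4 := cZ (- (2 * a)^-1) _ c3; have c5 := cZ (-1) _ cD.
rewrite (contour_integralD _ smooth); last 2 first.
- exact: cZ.
- by move=> j; apply: ccontD; [exact: c4|exact: c5].
rewrite (contour_integralD _ smooth)//.
by rewrite !(contour_integralZ _ smooth)// contour_integral_sqrtcDV//; ring.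
Qed.

(** For distinct poles, partial fractions give the divided difference [(a - b) / (a^2 - b^2)], which
    is [1 / (a + b)]; the double pole gives its limit [1 / (2 a)]. Positive real parts exclude
    [a = - b]. The common [w] records that both poles are encircled equally often. *)
Lemma contour_integral_sqrtc_resolventM a b (w : R[i]) :
  0 < Re a -> 0 < Re b ->
  (forall j t, Gamma j t != a ^+ 2) -> (forall j t, Gamma j t != b ^+ 2) ->
  contour_integral Gamma (fun z => (z - a ^+ 2)^-1) = w ->
  contour_integral Gamma (fun z => (z - b ^+ 2)^-1) = w ->
  contour_integral Gamma
    (fun z => sqrtc z * ((z - a ^+ 2)^-1 * (z - b ^+ 2)^-1)) =
  (a + b)^-1 * w.
Proof.
move=> a0 b0 aG bG wa wb.
have [<-|ab] := eqVneq a b.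
  by rewrite contour_integral_sqrtc_resolvent2// wa mulr2n mulrDl !mul1r.
have cs c : (forall j t, Gamma j t != c ^+ 2) ->
    ccont_on Gamma (fun z => sqrtc z * (z - c ^+ 2)^-1).
  move=> cG j; apply: ccontM; first exact: ccont_on_sqrtc.
  exact: ccont_on_subV.
have cZ (c : R[i]) f : ccont_on Gamma f -> ccont_on Gamma (fun z => c * f z).
  by move=> cf j; apply: ccontM; [exact: ccont_cst|exact: cf].
have ab0 := addc_neq0 _ _ a0 b0.
have amb : a - b != 0 by rewrite subr_eq0.
transitivity (contour_integral Gamma (fun z =>
   (a ^+ 2 - b ^+ 2)^-1 * (sqrtc z * (z - a ^+ 2)^-1) +
   (- (a ^+ 2 - b ^+ 2)^-1) * (sqrtc z * (z - b ^+ 2)^-1))).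
  apply: eq_contour_integral => j t; rewrite subr_sqr; field.
  by rewrite !subr_eq0 ab aG bG ab0.
rewrite (contour_integralD _ smooth); [|exact: cZ (cs a aG)|exact: cZ (cs b bG)].
rewrite !(contour_integralZ _ smooth); [|exact: cs..].
rewrite !contour_integral_sqrtc_resolvent// wa wb subr_sqr; field.
by rewrite ab0 amb.
Qed.

End SquareRootContourIntegrals.

(** * Perturbation of resolvents and of contour roots *)

Section EntrywiseNorm.
Context {R : realType}.

(** The entrywise sum is chosen because it is real-valued, submultiplicative with constant 1, and
    dominates both entries and trace. *)
Definition mxN {m n} (X : 'M[R[i]]_(m, n)) : R := \sum_i \sum_j normc (X i j).

Lemma mxN_ge0 m n (X : 'M[R[i]]_(m, n)) : 0 <= mxN X.
Proof. by apply: sumr_ge0 => i _; apply: sumr_ge0 => j _; exact: normc_ge0. Qed.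

Lemma mxN_entry m n (X : 'M[R[i]]_(m, n)) i j : normc (X i j) <= mxN X.
Proof.
rewrite /mxN (bigD1 i)//= (bigD1 j)//= -addrA lerDl addr_ge0//.
  by apply: sumr_ge0 => k _; exact: normc_ge0.
by apply: sumr_ge0 => k _; apply: sumr_ge0 => l _; exact: normc_ge0.
Qed.

Lemma mxN_eq0 m n (X : 'M[R[i]]_(m, n)) : mxN X <= 0 -> X = 0.
Proof.
move=> X0; apply/matrixP => i j; rewrite mxE; apply: eq0_normc.
by apply/eqP; rewrite eq_le normc_ge0 (le_trans (mxN_entry _ _ _ i j)).
Qed.

Lemma mxN0 m n : mxN (0 : 'M[R[i]]_(m, n)) = 0.
Proof. by rewrite /mxN big1// => i _; rewrite big1// => j _; rewrite mxE normc0. Qed.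

Lemma mxND m n (X Y : 'M[R[i]]_(m, n)) : mxN (X + Y) <= mxN X + mxN Y.
Proof.
rewrite /mxN -big_split/=; apply: ler_sum => i _.
rewrite -big_split/=; apply: ler_sum => j _.
by rewrite mxE; exact: normcD_le.
Qed.

Lemma mxNZ m n c (X : 'M[R[i]]_(m, n)) : mxN (c *: X) = normc c * mxN X.
Proof.
rewrite /mxN mulr_sumr; apply: eq_bigr => i _.
by rewrite mulr_sumr; apply: eq_bigr => j _; rewrite mxE normcM.
Qed.

Lemma mxN_sum m n (I : Type) (r : seq I) (P : pred I) (F : I -> 'M[R[i]]_(m, n)) :
  mxN (\sum_(i <- r | P i) F i) <= \sum_(i <- r | P i) mxN (F i).
Proof.
elim/big_ind2: _ => [|X x Y y hX hY|//]; first by rewrite mxN0.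
by apply: (le_trans (mxND _ _ _ _)); exact: lerD.
Qed.

Lemma normc_sum (I : Type) (r : seq I) (P : pred I) (F : I -> R[i]) :
  normc (\sum_(i <- r | P i) F i) <= \sum_(i <- r | P i) normc (F i).
Proof.
elim/big_ind2: _ => [|X x Y y hX hY|//]; first by rewrite normc0.
by apply: (le_trans (normcD_le _ _)); exact: lerD.
Qed.

Lemma mxNM m n p (X : 'M[R[i]]_(m, n)) (Y : 'M[R[i]]_(n, p)) :
  mxN (X *m Y) <= mxN X * mxN Y.
Proof.
apply: (@le_trans _ _ (\sum_i \sum_k \sum_j normc (X i j) * normc (Y j k))).
  apply: ler_sum => i _; apply: ler_sum => k _; rewrite mxE.
  by apply: (le_trans (normc_sum _ _ _ _)); under eq_bigr do rewrite normcM.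
rewrite /mxN mulr_suml; apply: ler_sum => i _.
rewrite exchange_big mulr_suml; apply: ler_sum => j _.
rewrite -mulr_sumr ler_wpM2l ?normc_ge0//.
rewrite (bigD1 j)//= lerDl.
by apply: sumr_ge0 => k _; apply: sumr_ge0 => l _; exact: normc_ge0.
Qed.

Lemma mxN_tr n (X : 'M[R[i]]_n) : normc (\tr X) <= mxN X.
Proof.
apply: (le_trans (normc_sum _ _ _ _)); apply: ler_sum => i _.
rewrite (bigD1 i)//= lerDl.
by apply: sumr_ge0 => k _; exact: normc_ge0.
Qed.

End EntrywiseNorm.

(** * Resolvents near a matrix with a complete system of projections *)

Section ResolventPerturbation.
Context {R : realType} {d : nat} (P : 'I_d -> 'M[R[i]]_d) (lam : 'I_d -> R[i]).
Context (PP : forall i j, P i *m P j = (if i == j then P i else 0)).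
Context (P1 : \sum_i P i = 1%:M).
Implicit Types (z : R[i]) (H : 'M[R[i]]_d).

Let M0 := \sum_i lam i *: P i.

Definition spectral_resolvent z := \sum_i (z - lam i)^-1 *: P i.

Lemma spectral_sumM (a b : 'I_d -> R[i]) :
  (\sum_i a i *: P i) *m (\sum_i b i *: P i) = \sum_i (a i * b i) *: P i.
Proof.
rewrite mulmx_suml; apply: eq_bigr => i _; rewrite mulmx_sumr (bigD1 i)//=.
rewrite -scalemxAl -scalemxAr PP eqxx scalerA big1 ?addr0// => j ji.
by rewrite -scalemxAl -scalemxAr PP eq_sym (negbTE ji) !scaler0.
Qed.

Lemma spectral_subM0 z : z%:M - M0 = \sum_i (z - lam i) *: P i.
Proof.
under eq_bigr do rewrite scalerBl.
by rewrite sumrB -scaler_sumr P1 scalemx1.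
Qed.

Lemma spectral_resolventP z : (forall i, z != lam i) ->
  spectral_resolvent z *m (z%:M - M0) = 1%:M /\
  (z%:M - M0) *m spectral_resolvent z = 1%:M.
Proof.
move=> zl; rewrite spectral_subM0 !spectral_sumM -P1; split;
  apply: eq_bigr => i _; rewrite ?mulVf ?mulfV ?scale1r ?subr_eq0//.
Qed.

Lemma invmx_spectral z : (forall i, z != lam i) ->
  invmx (z%:M - M0) = spectral_resolvent z.
Proof.
move=> /spectral_resolventP[h1 h2].
have [u _] := mulmx1_unit h2.
by rewrite -[RHS]mulmx1 -(mulmxV u) mulmxA h1 mul1mx.
Qed.

Context (r : R) (r0 : 0 < r).

Definition resolvent_bound := r^-1 * \sum_i mxN (P i).

Lemma resolvent_bound_ge0 : 0 <= resolvent_bound.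
Proof.
by rewrite mulr_ge0 ?invr_ge0 ?(ltW r0)// sumr_ge0// => i _; exact: mxN_ge0.
Qed.

Lemma mxN_spectral_resolvent z : (forall i, r <= normc (z - lam i)) ->
  mxN (spectral_resolvent z) <= resolvent_bound.
Proof.
move=> zr; apply: (le_trans (mxN_sum _ _ _ _ _ _)).
rewrite /resolvent_bound mulr_sumr; apply: ler_sum => i _.
rewrite mxNZ ler_wpM2r ?mxN_ge0// normcV lef_pV2 ?zr// posrE//.
exact: lt_le_trans (zr i).
Qed.

Lemma resolvent_gap_neq z : (forall i, r <= normc (z - lam i)) ->
  forall i, z != lam i.
Proof.
move=> zr i; apply/eqP => zi; have := zr i.
by rewrite zi subrr normc0 leNgt r0.
Qed.

(** With [T] the perturbed matrix and [S] the old resolvent, [T *m S = 1%:M - H *m S], where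
    [H *m S] has norm at most one half. Each claim comes from absorbing that half. *)
Lemma resolvent_perturbation z H : (forall i, r <= normc (z - lam i)) ->
  resolvent_bound * mxN H <= 2^-1 ->
  [/\ z%:M - (M0 + H) \in unitmx,
      mxN (invmx (z%:M - (M0 + H))) <= 2 * resolvent_bound &
      invmx (z%:M - (M0 + H)) = spectral_resolvent z +
        invmx (z%:M - (M0 + H)) *m H *m spectral_resolvent z].
Proof.
move=> zr Hs; set S := spectral_resolvent z; set T := z%:M - (M0 + H).
have [h1 h2] := spectral_resolventP _ (resolvent_gap_neq _ zr).
have KS := mxN_spectral_resolvent _ zr.
have TS : T *m S = 1%:M - H *m S.
  by rewrite /T opprD addrA mulmxBl h2.
have HS : mxN (H *m S) <= 2^-1.
  apply: (le_trans (mxNM _ _ _ _ _)); apply: le_trans Hs.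
  by rewrite mulrC ler_wpM2r ?mxN_ge0.
(* A matrix [N] with [N *m T = 0] satisfies [N = N *m (H *m S)], so its norm is at most half of
   itself. *)
have uT : T \in unitmx.
  rewrite -row_free_unit -kermx_eq0; apply/eqP.
  have : kermx T = kermx T *m (H *m S).
    apply/eqP; rewrite -subr_eq0 -[X in X - _]mulmx1 -mulmxBr -TS mulmxA.
    by rewrite mulmx_ker mul0mx.
  move=> e; apply: mxN_eq0.
  have : mxN (kermx T) <= mxN (kermx T) * 2^-1.
    rewrite {1}e; apply: (le_trans (mxNM _ _ _ _ _)).
    by rewrite ler_wpM2l ?mxN_ge0.
  by have := mxN_ge0 _ _ (kermx T); lra.
have e : invmx T = S + invmx T *m H *m S.
  rewrite -mulmxA -[X in X + _]mul1mx -(mulVmx uT) -mulmxA -mulmxDr TS.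
  by rewrite subrK mulmx1.
split=> //.
have : mxN (invmx T) <= resolvent_bound + mxN (invmx T) * 2^-1.
  rewrite {1}e; apply: (le_trans (mxND _ _ _ _)); apply: lerD => //.
  rewrite -mulmxA; apply: (le_trans (mxNM _ _ _ _ _)).
  by rewrite ler_wpM2l ?mxN_ge0.
by lra.
Qed.

Lemma resolvent_identity_iterated m (X S H : 'M[R[i]]_m) :
  X = S + X *m H *m S -> X = S + S *m H *m S + X *m H *m S *m H *m S.
Proof. by move=> eX; rewrite {1}eX {1}eX !mulmxDl addrA. Qed.

(** Contrapositive of the invertibility above: at distance at least [r] from every [lam i] the
    perturbed resolvent exists. *)
Lemma eigenvalue_perturbation z H : resolvent_bound * mxN H <= 2^-1 ->
  eigenvalue (M0 + H) z -> exists i, normc (z - lam i) < r.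
Proof.
move=> Hs /eigenvalueP[v vz v0].
have [//|nex] := pselect (exists i, normc (z - lam i) < r).
have zr i : r <= normc (z - lam i).
  by rewrite leNgt; apply/negP => h; apply: nex; exists i.
have [u _ _] := resolvent_perturbation _ _ zr Hs.
have : v *m (z%:M - (M0 + H)) = 0.
  by rewrite mulmxBr vz mul_mx_scalar subrr.
move=> /(congr1 (fun w => w *m invmx (z%:M - (M0 + H)))).
by rewrite mulmxK// mul0mx => v00; rewrite v00 eqxx in v0.
Qed.

End ResolventPerturbation.

(** * First-order expansion of the contour root *)

Section ContourSquareRootExpansion.
Context {R : realType} {d n : nat} (Gamma : 'I_n -> R -> R[i]).
Context (smooth : forall j, smooth_closed_curve (Gamma j)).
Context (slit : forall j t, slit_plane (Gamma j t)).
Context (P : 'I_d -> 'M[R[i]]_d) (al : 'I_d -> R[i]).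
Context (PP : forall i j, P i *m P j = (if i == j then P i else 0)).
Context (P1 : \sum_i P i = 1%:M).
Context (al0 : forall i, 0 < Re (al i)).
Context (wind : forall i,
  contour_integral Gamma (fun z => (z - al i ^+ 2)^-1) = two_pi_i).
Context (r : R) (r0 : 0 < r).
Context (gap : forall i j t, r <= normc (Gamma j t - al i ^+ 2)).
Implicit Types (z : R[i]) (H : 'M[R[i]]_d).

Let lam i := al i ^+ 2.
Let M0 := \sum_i lam i *: P i.
Let S z := spectral_resolvent P lam z.

Let Gamma_neq i j t : Gamma j t != al i ^+ 2.
Proof. exact: (resolvent_gap_neq lam _ r0 _ (fun i => gap i j t)). Qed.

Let two_pi_i_neq0 : two_pi_i != 0 :> R[i].
Proof.
apply/eqP => /(congr1 (@complex.Im R))/eqP.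
by rewrite /= gt_eqF// mulr_gt0// pi_gt0.
Qed.

Lemma contour_sqrt_spectral :
  contour_sqrt Gamma M0 = \sum_i al i *: P i.
Proof.
apply/matrixP => i j; rewrite mxE summxE.
rewrite (eq_contour_integral _ _
  (fun z => \sum_k P k i j * (sqrtc z * (z - al k ^+ 2)^-1))); last first.
  move=> l t; rewrite (invmx_spectral _ _ PP P1 _ (fun i => Gamma_neq i l t)).
  rewrite summxE mulr_sumr; apply: eq_bigr => k _.
  by rewrite mxE mulrA mulrC.
have cs k : ccont_on Gamma (fun z => sqrtc z * (z - al k ^+ 2)^-1).
  move=> l; apply: ccontM; first exact: ccont_on_sqrtc.
  exact: ccont_on_subV.
rewrite (contour_integral_sum _ smooth); last first.
  by move=> k l; apply: ccontM; [exact: ccont_cst|exact: cs].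
rewrite mulr_sumr; apply: eq_bigr => k _.
rewrite (contour_integralZ _ smooth)// contour_integral_sqrtc_resolvent//.
by rewrite wind mxE; field.
Qed.

(** The Daleckii-Krein formula: the weights are the divided differences of the square root at the
    eigenvalues [al k ^+ 2] and [al l ^+ 2]. *)
Definition sqrt_derivative H :=
  \sum_k \sum_l (al k + al l)^-1 *: (P k *m H *m P l).

Lemma contour_sqrt_expansion : exists2 delta, 0 < delta &
  exists2 C, 0 < C & forall H, mxN H <= delta ->
    mxN (contour_sqrt Gamma (M0 + H) - contour_sqrt Gamma M0
         - sqrt_derivative H) <= C * mxN H ^+ 2.
Proof.
pose K := resolvent_bound P r.
have K0 : 0 <= K by exact: resolvent_bound_ge0.
have [B B0 hB] := contour_integral_bound _ smooth _ (ccont_on_sqrtc _ smooth slit).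
(* This radius forces [K * mxN H <= 2^-1]; taking [K + 1] avoids dividing by zero. *)
exists (2 * (K + 1))^-1; first by rewrite invr_gt0 mulr_gt0// ltr_wpDl.
(* The two factors [d] count entries, [B] bounds integration against the square root, and
   [2 * K * K * K] bounds the perturbed resolvent times two unperturbed ones in the remainder. *)
exists (d%:R * (d%:R * (normc (two_pi_i^-1 : R[i]) * (B * (2 * K * K * K)))) + 1).
  rewrite ltr_wpDl// mulr_ge0// mulr_ge0// mulr_ge0 ?normc_ge0//.
  by rewrite mulr_ge0 ?(ltW B0)// mulr_ge0// mulr_ge0// mulr_ge0.
move=> H Hs.
have KH : K * mxN H <= 2^-1.
  have : (K + 1) * mxN H <= 2^-1.
    have k1 : 0 < K + 1 by rewrite ltr_wpDl.
    apply: (le_trans (ler_wpM2l (ltW k1) Hs)).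
    by rewrite invfM mulrCA mulfV ?mulr1// gt_eqF.
  by apply: le_trans; rewrite ler_wpM2r ?mxN_ge0// lerDl.
pose X z := invmx (z%:M - (M0 + H)).
have hX j t := resolvent_perturbation P lam PP P1 r r0 (Gamma j t) H
  (fun i => gap i j t) KH.
pose E z i j := (X z *m H *m S z *m H *m S z) i j.
have XE j t : X (Gamma j t) = S (Gamma j t) + S (Gamma j t) *m H *m S (Gamma j t)
    + X (Gamma j t) *m H *m S (Gamma j t) *m H *m S (Gamma j t).
  by have [_ _ e] := hX j t; exact: (resolvent_identity_iterated _ _ _ _ e).
have cX i j : ccont_on Gamma (fun z => X z i j).
  move=> l; apply: ccont_invmx => [k m|t]; last by have [] := hX l t.
  under eq_fun do rewrite mxE [X in X + _]mxE.
  apply: ccontD; last exact: ccont_cst.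
  case: (k == m); first by under eq_fun do rewrite mulr1n; exact: ccont_curve.
  by under eq_fun do rewrite mulr0n; exact: ccont_cst.
have cu := ccont_on_sqrtc _ smooth slit.
have cV k : ccont_on Gamma (fun z => (z - al k ^+ 2)^-1).
  exact: ccont_on_subV.
have cS i j : ccont_on Gamma (fun z => S z i j).
  move=> l; under eq_fun do rewrite summxE.
  apply: ccont_sum => k; under eq_fun do rewrite mxE.
  by apply: ccontM; [exact: cV|exact: ccont_cst].
have cM p q s (Y : R[i] -> 'M[R[i]]_(p, q)) (Z : R[i] -> 'M[R[i]]_(q, s)) :
    (forall i j, ccont_on Gamma (fun z => Y z i j)) ->
    (forall i j, ccont_on Gamma (fun z => Z z i j)) ->
    forall i j, ccont_on Gamma (fun z => (Y z *m Z z) i j).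
  move=> cY cZ i j l; under eq_fun do rewrite mxE.
  by apply: ccont_sum => k; apply: ccontM; [exact: cY|exact: cZ].
have cH i j : ccont_on Gamma (fun=> H i j) by move=> l; exact: ccont_cst.
have cE i j : ccont_on Gamma (fun z => E z i j).
  by rewrite /E; apply: (cM) => //; apply: (cM) => //; apply: (cM) => //; apply: (cM).
have Ele i j l t : normc (E (Gamma l t) i j) <= 2 * K * K * K * mxN H ^+ 2.
  have [_ XK _] := hX l t.
  have SK := mxN_spectral_resolvent P lam r r0 _ (fun i => gap i l t).
  rewrite /E; apply: (le_trans (mxN_entry _ _ _ _ _)).
  apply: (@le_trans _ _ (2 * K * mxN H * K * mxN H * K)); last first.
    by rewrite le_eqVlt; apply/orP; left; apply/eqP; ring.
  have mstep p (Y : 'M[R[i]]_d) (Z : 'M[R[i]]_d) b : mxN Y <= p -> mxN Z <= b ->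
      mxN (Y *m Z) <= p * b.
    move=> hY hZ; apply: (le_trans (mxNM _ _ _ _ _)).
    by apply: ler_pM; rewrite ?mxN_ge0.
  by apply: (mstep) => //; apply: (mstep) => //; apply: (mstep) => //; apply: (mstep).
(* Of the three terms of the iterated resolvent identity, the first integrates to the root, the
   second to its derivative, and only [E] survives. *)
have key i j : (contour_sqrt Gamma (M0 + H) - contour_sqrt Gamma M0
     - sqrt_derivative H) i j =
   two_pi_i^-1 * contour_integral Gamma (fun z => sqrtc z * E z i j).
  have cSHS : ccont_on Gamma (fun z => (S z *m H *m S z) i j).
    by apply: (cM) => //; apply: (cM).
  have cuM f : ccont_on Gamma f -> ccont_on Gamma (fun z => sqrtc z * f z).
    by move=> cf l; apply: ccontM; [exact: cu|exact: cf].
  have e0 : contour_sqrt Gamma (M0 + H) i j = two_pi_i^-1 *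
      (contour_integral Gamma (fun z => sqrtc z * S z i j) +
       (contour_integral Gamma (fun z => sqrtc z * (S z *m H *m S z) i j) +
        contour_integral Gamma (fun z => sqrtc z * E z i j))).
    rewrite mxE; congr (_ * _).
    have c1 := cuM _ (cS i j); have c2 := cuM _ cSHS; have c3 := cuM _ (cE i j).
    rewrite -(contour_integralD _ smooth _ _ c2 c3) -(contour_integralD _ smooth _ _ c1).
      2: by move=> l; apply: ccontD; [exact: c2|exact: c3].
    apply: eq_contour_integral => l t.
    by rewrite -/(X _) XE /E !mxE !mulrDr addrA.
  have e1 : contour_sqrt Gamma M0 i j =
      two_pi_i^-1 * contour_integral Gamma (fun z => sqrtc z * S z i j).
    rewrite mxE; congr (_ * _); apply: eq_contour_integral => l t.
    by rewrite (invmx_spectral _ _ PP P1 _ (fun i => Gamma_neq i l t)).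
  have e2 : sqrt_derivative H i j = two_pi_i^-1 *
      contour_integral Gamma (fun z => sqrtc z * (S z *m H *m S z) i j).
    rewrite (eq_contour_integral _ _ (fun z => \sum_k \sum_l
       (P k *m H *m P l) i j *
       (sqrtc z * ((z - al k ^+ 2)^-1 * (z - al l ^+ 2)^-1)))); last first.
      move=> l t; rewrite /S /spectral_resolvent -mulmxA mulmx_suml summxE.
      rewrite mulr_sumr; apply: eq_bigr => k _.
      rewrite !mulmx_sumr summxE mulr_sumr; apply: eq_bigr => m _.
      rewrite -!scalemxAl -!scalemxAr mulmxA !mxE; ring.
    have cc k l : ccont_on Gamma (fun z =>
        sqrtc z * ((z - al k ^+ 2)^-1 * (z - al l ^+ 2)^-1)).
      by apply: cuM => m; apply: ccontM; exact: cV.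
    have cc2 k l : ccont_on Gamma (fun z => (P k *m H *m P l) i j *
        (sqrtc z * ((z - al k ^+ 2)^-1 * (z - al l ^+ 2)^-1))).
      by move=> m; apply: ccontM; [exact: ccont_cst|exact: cc].
    rewrite (contour_integral_sum _ smooth); last first.
      by move=> k m; apply: ccont_sum => l; exact: cc2.
    rewrite mulr_sumr summxE; apply: eq_bigr => k _.
    rewrite (contour_integral_sum _ smooth); last by move=> l; exact: cc2.
    rewrite mulr_sumr summxE; apply: eq_bigr => l _.
    rewrite (contour_integralZ _ smooth); last exact: cc.
    rewrite (contour_integral_sqrtc_resolventM _ smooth slit _ _ two_pi_i)//.
    have := addc_neq0 _ _ (al0 k) (al0 l).
    by rewrite mxE => h; field; rewrite h two_pi_i_neq0.
  rewrite mxE [X in X + _ = _]mxE [X in _ + X + _ = _]mxE [X in _ + _ + X = _]mxE.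
  have lin (c x y e u v w : R[i]) : u = c * (x + (y + e)) -> v = c * x ->
      w = c * y -> u - v - w = c * e by move=> -> -> ->; ring.
  exact: (lin _ _ _ _ _ _ _ e0 e1 e2).
have entry i j : normc ((contour_sqrt Gamma (M0 + H) - contour_sqrt Gamma M0
     - sqrt_derivative H) i j) <=
   normc (two_pi_i^-1 : R[i]) * (B * (2 * K * K * K)) * mxN H ^+ 2.
  have m0 : 0 <= 2 * K * K * K * mxN H ^+ 2.
    apply: mulr_ge0; last by rewrite exprn_ge0// mxN_ge0.
    by apply: mulr_ge0 => //; apply: mulr_ge0 => //; exact: mulr_ge0.
  have h := hB _ _ (cE i j) m0 (Ele i j).
  rewrite key normcM; apply: (le_trans (ler_wpM2l (normc_ge0 _) h)).
  by rewrite !mulrA.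
rewrite mulrDl mul1r; apply: (@le_trans _ _ (d%:R * (d%:R *
  (normc (two_pi_i^-1 : R[i]) * (B * (2 * K * K * K)) * mxN H ^+ 2)))).
  apply: (@le_trans _ _ (\sum_(i < d) \sum_(j < d)
      normc (two_pi_i^-1 : R[i]) * (B * (2 * K * K * K)) * mxN H ^+ 2)).
    by apply: ler_sum => i _; apply: ler_sum => j _; exact: entry.
  by rewrite !sumr_const card_ord -[leLHS]mulr_natl -[X in d%:R * X <= _]mulr_natl.
by rewrite !mulrA lerDl exprn_ge0// mxN_ge0.
Qed.

End ContourSquareRootExpansion.

(** * Spectral theorem for real symmetric matrices *)

Section SpectralTheorem.
Context {R : realType}.

(** Evaluating [w A w^*] from both sides gives [a] and its conjugate times the nonzero number
    [w w^*]. *)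
Lemma real_eigenvalue_symmetric d (A : 'M[R]_d) (a : R[i]) :
  A^T = A -> eigenvalue (toC A) a -> a = (Re a)%:C.
Proof.
move=> sA /eigenvalueP[w wA w0].
pose W := (map_mx (@conjc R) w)^T.
have WA : toC A *m W = a^*%C *: W.
  rewrite /W /toC -{1}sA -(map_trmx (real_complex R) A) -trmx_mul -/(toC A).
  have -> : map_mx (@conjc R) w *m toC A = map_mx (@conjc R) (w *m toC A).
    rewrite map_mxM; congr (_ *m _); apply/matrixP => i j.
    by rewrite !mxE; apply: complex_ext; rewrite /= ?oppr0.
  by rewrite wA map_mxZ linearZ.
have s0 : (w *m W) 0 0 != 0.
  apply: contra w0 => /eqP; rewrite mxE => h.
  have h0 j : (w 0 j) * (w 0 j)^*%C = 0.
    have hk k : true -> 0 <= w 0 k * W k 0.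
      by move=> _; rewrite !mxE; exact: mulcJ_ge0.
    by have := @psumr_eq0P _ _ _ _ hk h j isT; rewrite !mxE.
  apply/eqP/rowP => j; rewrite mxE; have := h0 j.
  by move=> /eqP; rewrite mulf_eq0 conjc_eq0 orbb => /eqP.
have e : a * (w *m W) 0 0 = a^*%C * (w *m W) 0 0.
  have := mulmxA w (toC A) W; rewrite wA WA -scalemxAl -scalemxAr.
  by move/matrixP/(_ 0 0); rewrite !mxE => ->.
have {e} := mulIf s0 e; case: a {wA WA} => x y /= [/eqP].
by rewrite -addr_eq0 -mulr2n mulrn_eq0 /= => /eqP ->.
Qed.

(** The restriction of [A] to the stable space has a complex eigenvalue by algebraic closure. It is
    an eigenvalue of [A] too, hence real, and so has a real eigenvector in that space. *)
Lemma symmetric_eigenvector_stable d (A V : 'M[R]_d) :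
  A^T = A -> (V *m A <= V)%MS -> (0 < \rank V)%N ->
  exists (a : R) (w : 'rV[R]_d), [/\ w *m A = a *: w, w != 0 & (w <= V)%MS].
Proof.
move=> sA VA rV; pose B := complex.restrict V A.
have BV : B *m row_base V = row_base V *m A.
  by rewrite /B /complex.restrict mulmxKpV// complex.stable_row_base.
have [a aB] := eigenvalue_closed (map_mx (real_complex R) B) rV.
have ra : a = (Re a)%:C.
  apply: (@real_eigenvalue_symmetric _ A) => //.
  have /eigenvalueP[v vB v0] := aB; apply/eigenvalueP.
  exists (v *m map_mx (real_complex R) (row_base V)).
    by rewrite -mulmxA -map_mxM -BV map_mxM mulmxA vB scalemxAl.
  by rewrite complex.mul_mx_rowfree_eq0// row_free_map row_base_free.
move: aB; rewrite ra eigenvalue_map => /eigenvalueP[v vB v0].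
exists (Re a), (v *m row_base V); split.
- by rewrite -mulmxA -BV mulmxA vB scalemxAl.
- by rewrite complex.mul_mx_rowfree_eq0// row_base_free.
- by rewrite (submx_trans (submxMl _ _))// eq_row_base.
Qed.

Lemma dot_gt0 d (w : 'rV[R]_d) : w != 0 -> 0 < (w *m w^T) 0 0.
Proof.
move=> w0; rewrite mxE lt_def; apply/andP; split; last first.
  by apply: sumr_ge0 => i _; rewrite mxE -expr2 sqr_ge0.
apply: contra w0 => /eqP h; apply/eqP/rowP => j; rewrite mxE.
have hk k : true -> 0 <= w 0 k * w^T k 0.
  by move=> _; rewrite mxE -expr2 sqr_ge0.
have := @psumr_eq0P _ _ _ _ hk h j isT; rewrite mxE => /eqP.
by rewrite -expr2 sqrf_eq0 => /eqP.
Qed.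

(** Induction on the number [k] of eigenvectors, with [A] fixed: the orthogonal complement of the
    rows found so far is stable by symmetry and nonzero while [k < d]. *)
Lemma symmetric_orthonormal_eigenvectors d (A : 'M[R]_d) : A^T = A ->
  forall k, (k <= d)%N -> exists (U : 'M[R]_(k, d)) (l : 'rV[R]_k),
    U *m U^T = 1%:M /\ U *m A = diag_mx l *m U.
Proof.
move=> sA; elim=> [_|k ih kd].
  by exists 0, 0; split; apply/matrixP; case.
have [U [l [UU UA]]] := ih (ltnW kd).
have VA : (kermx U^T *m A <= kermx U^T)%MS.
  apply/sub_kermxP.
  rewrite -mulmxA -{1}sA -trmx_mul UA trmx_mul mulmxA mulmx_ker mul0mx//.
have rV : (0 < \rank (kermx U^T))%N.
  rewrite mxrank_ker subn_gt0 (leq_ltn_trans _ kd)//.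
  by rewrite mxrank_tr rank_leq_row.
have [a [w [wA w0 wV]]] := symmetric_eigenvector_stable _ _ _ sA VA rV.
have s0 := dot_gt0 _ _ w0; set s := (w *m w^T) 0 0 in s0.
pose u := (Num.sqrt s)^-1 *: w.
have uu : u *m u^T = 1%:M.
  rewrite /u linearZ/= -scalemxAl -scalemxAr scalerA [w *m w^T]mx11_scalar -/s.
  rewrite -invfM -expr2 sqr_sqrtr ?ltW// -mul_scalar_mx -scalar_mxM.
  by rewrite mulVf// gt_eqF.
have uU : u *m U^T = 0.
  by rewrite /u -scalemxAl (sub_kermxP wV) scaler0.
have uA : u *m A = a%:M *m u.
  by rewrite /u -scalemxAl wA mul_scalar_mx scalerA mulrC scalerA.
(* [1 + k] is convertible to [k.+1] and is the shape that block matrices require. *)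
suff: exists (U' : 'M[R]_(1 + k, d)) (l' : 'rV[R]_(1 + k)),
  U' *m U'^T = 1%:M /\ U' *m A = diag_mx l' *m U' by [].
exists (col_mx u U), (row_mx a%:M l).
split.
  rewrite tr_col_mx mul_col_row uu UU uU.
  have -> : U *m u^T = 0 by apply: trmx_inj; rewrite trmx_mul trmxK uU trmx0.
  by rewrite -scalar_mx_block.
rewrite mul_col_mx uA UA diag_mx_row mul_block_col !mul0mx addr0 add0r.
by congr (col_mx (_ *m _) _); apply/matrixP => i j; rewrite !ord1 !mxE.
Qed.

End SpectralTheorem.

(** * Existence and consequences of eigenvalue decompositions *)

Section EigenDecomposition.
Context {R : realType} {d : nat}.
Implicit Types (A : 'M[R]_d) (lam : 'I_d -> R) (p : 'I_d -> 'cV[R]_d).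

Lemma spd_eigen_decomposition A : spd A ->
  exists lam p, eigen_decomposition A lam p.
Proof.
move=> [sA pA].
have [U [l [UU UA]]] := symmetric_orthonormal_eigenvectors _ _ sA _ (leqnn d).
have UU' : U^T *m U = 1%:M by exact: mulmx1C.
pose p i := (row i U)^T.
have pp i j : (p i)^T *m p j = (i == j)%:R%:M.
  apply/matrixP => x y; rewrite !ord1 trmxK.
  have := congr1 (fun M : 'M[R]_d => M i j) UU; rewrite !mxE eqxx mulr1n => <-.
  by apply: eq_bigr => k _; rewrite !mxE.
have pA' i : (p i)^T *m A = l 0 i *: (p i)^T.
  rewrite trmxK -row_mul UA; apply/rowP => j.
  by rewrite mxE mul_diag_mx !mxE.
have p0 i : p i != 0.
  apply/eqP => p0; have := pp i i; rewrite p0 mulmx0 eqxx => /matrixP/(_ 0 0).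
  by rewrite !mxE => /eqP; rewrite eq_sym oner_eq0.
exists (fun i => l 0 i), p; split.
- move=> i; have := pA _ (p0 i); rewrite pA' -scalemxAl pp eqxx.
  by rewrite !mxE mulr1.
- move=> i j; rewrite /proj1d mulmxA -(mulmxA _ _ (p j)) pp mul_mx_scalar.
  by case: eqVneq => [->|_]; rewrite ?scale1r// scale0r mul0mx.
- move=> i; apply/eqP; rewrite eqn_leq; apply/andP; split.
    by rewrite (leq_trans (mxrankM_maxl _ _))// rank_leq_col.
  rewrite lt0n mxrank_eq0; apply/eqP => h.
  have : (p i)^T *m proj1d (p i) *m p i = 1%:M.
    by rewrite /proj1d !mulmxA pp eqxx mul1mx pp eqxx.
  rewrite h mulmx0 mul0mx => /matrixP/(_ 0 0); rewrite !mxE => /eqP.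
  by rewrite eq_sym oner_eq0.
- rewrite -[LHS]mul1mx -UU' -mulmxA UA; apply/matrixP => i j.
  rewrite mxE summxE; apply: eq_bigr => k _.
  by rewrite mul_diag_mx !mxE big_ord1 !mxE; ring.
Qed.

Context {A : 'M[R]_d} {lam : 'I_d -> R} {p : 'I_d -> 'cV[R]_d}.
Context (dA : eigen_decomposition A lam p).

(** Idempotence says that [proj1d (p i)] is its own multiple by the squared length of [p i], and
    rank one makes it nonzero, so the length is 1. Sandwiching a vanishing product between the unit
    vectors then leaves their scalar product. *)
Lemma eigen_orthonormal i j : (p i)^T *m p j = (i == j)%:R%:M.
Proof.
have [_ PP rP _] := dA.
have P0 k : proj1d (p k) != 0 by rewrite -mxrank_eq0 rP.
have h k : (p k)^T *m p k = 1%:M.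
  rewrite [LHS]mx11_scalar; congr (_%:M); set c := (_ *m _) 0 0.
  have := PP k k; rewrite eqxx {1 2}/proj1d mulmxA -(mulmxA _ _ (p k)).
  rewrite [_^T *m _]mx11_scalar -/c mul_mx_scalar -scalemxAl -/(proj1d _).
  move/eqP; rewrite -subr_eq0 -[X in _ - X]scale1r -scalerBl scaler_eq0.
  by rewrite (negbTE (P0 k)) orbF subr_eq0 => /eqP.
have [->|ij] := eqVneq i j; first exact: h.

have := PP i j; rewrite (negbTE ij) /proj1d mulmxA -(mulmxA _ _ (p j)).
rewrite [_^T *m _]mx11_scalar; set c := (_ *m _) 0 0.
move=> /(congr1 (fun M => (p i)^T *m M *m p j)).
rewrite mul_mx_scalar -scalemxAl -scalemxAr -scalemxAl mulmx0 mul0mx.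
rewrite mulmxA h mul1mx h => /matrixP/(_ 0 0); rewrite !mxE mulr1 => c0.
by rewrite [LHS]mx11_scalar mxE c0.
Qed.

(** There are exactly [d] orthonormal vectors, so the square matrix of them is orthogonal on both
    sides. *)
Lemma eigen_proj_sum : \sum_i proj1d (p i) = 1%:M.
Proof.
pose U := \matrix_(i < d, j < d) p i j 0.
have UU : U *m U^T = 1%:M.
  apply/matrixP => i j; have /matrixP/(_ 0 0) := eigen_orthonormal i j.
  rewrite !mxE mulr1n => <-; apply: eq_bigr => k _; rewrite !mxE//.
rewrite -(mulmx1C UU); apply/matrixP => i j; rewrite summxE mxE.
by apply: eq_bigr => k _; rewrite !mxE big_ord1 !mxE.
Qed.

Lemma eigen_vector j : A *m p j = lam j *: p j.
Proof.
have [_ _ _ ->] := dA; rewrite mulmx_suml (bigD1 j)//= big1 ?addr0.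
  by rewrite -scalemxAl /proj1d -mulmxA eigen_orthonormal eqxx mulmx1.
move=> i ij; rewrite -scalemxAl /proj1d -mulmxA eigen_orthonormal (negbTE ij).
by rewrite mul_mx_scalar scale0r scaler0.
Qed.

Lemma eigen_trmx : A^T = A.
Proof.
have [_ _ _ {2}->] := dA; have [_ _ _ ->] := dA.
rewrite raddf_sum; apply: eq_bigr => i _ /=.
by rewrite linearZ/= /proj1d trmx_mul trmxK.
Qed.

Lemma eigen_in_spectrum i : eigenvalue (toC A) (lam i)%:C.
Proof.
apply/eigenvalueP; exists (map_mx (real_complex R) (p i)^T).
  rewrite -map_mxM -map_mxZ; congr map_mx.
  by apply: trmx_inj; rewrite trmx_mul trmxK eigen_trmx eigen_vector linearZ/= trmxK.
rewrite map_mx_eq0; apply/eqP => p0; have := eigen_orthonormal i i.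
rewrite p0 mul0mx eqxx => /matrixP/(_ 0 0); rewrite !mxE => /eqP.
by rewrite eq_sym oner_eq0.
Qed.

End EigenDecomposition.

Section SquareRoot.
Context {R : realType} {d : nat}.
Implicit Types (A : 'M[R]_d) (lam : 'I_d -> R) (p : 'I_d -> 'cV[R]_d).

(** Both sums are expanded over the products of a projection of each decomposition. Evaluating
    [(p' i)^T *m A *m p j] in two ways shows that the overlap [c] vanishes unless [lam j = lam' i],
    so repeated eigenvalues call for no grouping. *)
Lemma eigen_sqrt_unique {A lam p lam' p'} :
  eigen_decomposition A lam p -> eigen_decomposition A lam' p' ->
  \sum_i Num.sqrt (lam i) *: proj1d (p i) =
  \sum_i Num.sqrt (lam' i) *: proj1d (p' i).
Proof.
move=> dA dA'.
rewrite -[LHS]mul1mx -(eigen_proj_sum dA') -[RHS]mulmx1 -(eigen_proj_sum dA).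
rewrite !mulmx_suml; apply: eq_bigr => i _.
rewrite !mulmx_sumr; apply: eq_bigr => j _.
rewrite -scalemxAl -scalemxAr /proj1d !mulmxA -(mulmxA (p' i) _ (p j)).
rewrite [_^T *m _]mx11_scalar; set c := (_ *m _) 0 0.
rewrite mul_mx_scalar -scalemxAl !scalerA; congr (_ *: _).
have e : lam j * c = lam' i * c.
  have h1 : (p' i)^T *m A *m p j = lam j *: ((p' i)^T *m p j).
    by rewrite -mulmxA (eigen_vector dA) scalemxAr.
  have h2 : (p' i)^T *m A *m p j = lam' i *: ((p' i)^T *m p j).
    rewrite -{1}(eigen_trmx dA) -trmx_mul (eigen_vector dA') linearZ/=.
    by rewrite -scalemxAl.
  by move: h1; rewrite h2 => /matrixP/(_ 0 0); rewrite [LHS]mxE [RHS]mxE => ->.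
have [->|c0] := eqVneq c 0; first by rewrite !mulr0.
by rewrite (mulIf c0 e).
Qed.

Lemma spd_sqrtE {A lam p} : eigen_decomposition A lam p ->
  spd_sqrt A = \sum_i Num.sqrt (lam i) *: proj1d (p i).
Proof.
move=> dA; rewrite /spd_sqrt; case: xgetP => [S _ [lam' [p' [dA' ->]]]|h].
  exact: eigen_sqrt_unique dA' dA.
by case: (h (\sum_i Num.sqrt (lam i) *: proj1d (p i))); exists lam, p.
Qed.

Lemma toC_proj_mul {A lam p} : eigen_decomposition A lam p ->
  forall i j, toC (proj1d (p i)) *m toC (proj1d (p j)) =
    (if i == j then toC (proj1d (p i)) else 0).
Proof.
move=> [_ PP _ _] i j; rewrite -map_mxM PP; case: eqP => // _.
exact: map_mx0.
Qed.

Lemma toC_proj_sum {A lam p} : eigen_decomposition A lam p ->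
  \sum_i toC (proj1d (p i)) = 1%:M.
Proof.
by move=> dA; rewrite -map_mx_sum (eigen_proj_sum dA) map_mx1.
Qed.

Lemma toC_eigen_sum (c : 'I_d -> R) p :
  toC (\sum_i c i *: proj1d (p i)) = \sum_i (c i)%:C *: toC (proj1d (p i)).
Proof. by rewrite /toC map_mx_sum; apply: eq_bigr => i _; rewrite map_mxZ. Qed.

End SquareRoot.

(** * Orders of vanishing *)

Section OrderOfVanishing.
Context {R : realType} {V : normedModType R}.
Implicit Types (f g : V -> R).

(** The bound O(|h|^k) at the origin; [k = 0] means locally bounded. Natural exponents let orders
    add under products. *)
Definition vanishes_to k f := exists2 C : R, 0 <= C &
  \forall h \near (0 : V), `|f h| <= C * `|h| ^+ k.

Lemma vanishes_to_le k f g : vanishes_to k g -> (forall h, `|f h| <= `|g h|) ->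
  vanishes_to k f.
Proof.
move=> [C C0 hC] fg; exists C => //; near=> h.
by apply: (le_trans (fg h)); near: h.
Unshelve. all: by end_near. Qed.

Lemma vanishes_to_cst (c : R) : vanishes_to 0 (fun=> c).
Proof. by exists `|c| => //; near=> h; rewrite expr0 mulr1. Unshelve. all: by end_near. Qed.

Lemma vanishes_to_norm : vanishes_to 1 (fun h => `|h|).
Proof.
by exists 1 => //; near=> h; rewrite expr1 mul1r normr_id.
Unshelve. all: by end_near. Qed.

Lemma vanishes_toD k f g : vanishes_to k f -> vanishes_to k g ->
  vanishes_to k (fun h => f h + g h).
Proof.
move=> [C C0 hC] [D D0 hD]; exists (C + D); first exact: addr_ge0.
near=> h; rewrite mulrDl (le_trans (ler_normD _ _))//.
by apply: lerD; near: h.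
Unshelve. all: by end_near. Qed.

Lemma vanishes_toM k l f g : vanishes_to k f -> vanishes_to l g ->
  vanishes_to (k + l) (fun h => f h * g h).
Proof.
move=> [C C0 hC] [D D0 hD]; exists (C * D); first exact: mulr_ge0.
near=> h; rewrite exprD mulrACA normrM.
by apply: ler_pM => //; near: h.
Unshelve. all: by end_near. Qed.

Lemma vanishes_toZ k (c : R) f : vanishes_to k f ->
  vanishes_to k (fun h => c * f h).
Proof. by move/(vanishes_toM 0 k _ _ (vanishes_to_cst c)). Qed.

Lemma vanishes_to_sum k (I : Type) (r : seq I) (F : I -> V -> R) :
  (forall i, vanishes_to k (F i)) -> vanishes_to k (fun h => \sum_(i <- r) F i h).
Proof.
move=> vF; elim: r => [|i r ih].
  exists 0 => //; near=> h.
  by rewrite big_nil normr0 mul0r.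
apply: (vanishes_to_le _ _ _ (vanishes_toD _ _ _ (vF i) ih)) => h.
by rewrite big_cons.
Unshelve. all: by end_near. Qed.

Lemma vanishes_to_weaken k f : vanishes_to k.+1 f -> vanishes_to k f.
Proof.
move=> [C C0 hC]; exists C => //; near=> h.
have h1 : `|h| <= 1.
  by near: h; apply/nbhs_norm0P; exists 1 => //= h /ltW.
apply: (@le_trans _ _ (C * `|h| ^+ k.+1)); first by near: h.
by rewrite exprS ler_wpM2l// ler_piMl// exprn_ge0.
Unshelve. all: by end_near. Qed.

Lemma vanishes_to_small f (e : R) : vanishes_to 1 f -> 0 < e ->
  \forall h \near (0 : V), `|f h| <= e.
Proof.
move=> [C C0 hC] e0; near=> h.
have he : `|h| <= (C + 1)^-1 * e.
  near: h; apply/nbhs_norm0P; exists ((C + 1)^-1 * e) => /=.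
    by rewrite mulr_gt0// invr_gt0 ltr_wpDl.
  by move=> h /ltW.
apply: (@le_trans _ _ (C * `|h| ^+ 1)); first by near: h.
have C1 : 0 < C + 1 by rewrite ltr_wpDl.
apply: (@le_trans _ _ ((C + 1) * ((C + 1)^-1 * e))).
  by rewrite expr1; apply: ler_pM => //; rewrite lerDl.
by rewrite mulrA mulfV ?mul1r// gt_eqF.
Unshelve. all: by end_near. Qed.

(** Composition of orders. The hypothesis is local because the root expansions hold for small
    perturbations only. *)
Lemma vanishes_to_near_le k l C f (g : V -> R) : vanishes_to k g -> 0 <= C ->
  (\forall h \near (0 : V), `|f h| <= C * `|g h| ^+ l) ->
  vanishes_to (k * l) f.
Proof.
move=> [D D0 hD] C0 hf; exists (C * D ^+ l); first by rewrite mulr_ge0 ?exprn_ge0.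
near=> h; apply: (@le_trans _ _ (C * `|g h| ^+ l)); first by near: h.
rewrite -mulrA exprM -exprMn ler_wpM2l//.
by apply: lerXn2r; rewrite ?nnegrE ?mulr_ge0 ?exprn_ge0//; near: h.
Unshelve. all: by end_near. Qed.

Definition mxvanishes_to k {m n} (F : V -> 'M[R[i]]_(m, n)) :=
  vanishes_to k (fun h => mxN (F h)).

Lemma mxvanishes_toD k m n (F G : V -> 'M[R[i]]_(m, n)) :
  mxvanishes_to k F -> mxvanishes_to k G -> mxvanishes_to k (fun h => F h + G h).
Proof.
move=> vF vG; apply: (vanishes_to_le _ _ _ (vanishes_toD _ _ _ vF vG)) => h.
by rewrite !ger0_norm ?addr_ge0 ?mxN_ge0//; exact: mxND.
Qed.

Lemma mxvanishes_toM k l m n p (F : V -> 'M[R[i]]_(m, n))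
    (G : V -> 'M[R[i]]_(n, p)) :
  mxvanishes_to k F -> mxvanishes_to l G ->
  mxvanishes_to (k + l) (fun h => F h *m G h).
Proof.
move=> vF vG; apply: (vanishes_to_le _ _ _ (vanishes_toM _ _ _ _ vF vG)) => h.
by rewrite !ger0_norm ?mulr_ge0 ?mxN_ge0//; exact: mxNM.
Qed.

Lemma mxvanishes_to_cst m n (X : 'M[R[i]]_(m, n)) :
  mxvanishes_to 0 (fun=> X).
Proof. exact: vanishes_to_cst. Qed.

Lemma mxvanishes_toMl k m n p (X : 'M[R[i]]_(m, n)) (G : V -> 'M[R[i]]_(n, p)) :
  mxvanishes_to k G -> mxvanishes_to k (fun h => X *m G h).
Proof. by move/(mxvanishes_toM 0 k _ _ _ _ _ (mxvanishes_to_cst _ _ X)). Qed.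

Lemma mxvanishes_toMr k m n p (G : V -> 'M[R[i]]_(m, n)) (X : 'M[R[i]]_(n, p)) :
  mxvanishes_to k G -> mxvanishes_to k (fun h => G h *m X).
Proof.
by move/mxvanishes_toM => /(_ _ _ _ (mxvanishes_to_cst _ _ X)); rewrite addn0.
Qed.

Lemma mxvanishes_toZ k m n (c : R[i]) (G : V -> 'M[R[i]]_(m, n)) :
  mxvanishes_to k G -> mxvanishes_to k (fun h => c *: G h).
Proof.
move=> vG; apply: (vanishes_to_le _ _ _ (vanishes_toZ _ (normc c) _ vG)) => h.
by rewrite mxNZ.
Qed.

Lemma mxvanishes_to_sum k m n (I : Type) (r : seq I)
    (F : I -> V -> 'M[R[i]]_(m, n)) :
  (forall i, mxvanishes_to k (F i)) ->
  mxvanishes_to k (fun h => \sum_(i <- r) F i h).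
Proof.
move=> vF; apply: (vanishes_to_le _ _ _ (vanishes_to_sum _ _ r _ vF)) => h.
rewrite !ger0_norm ?mxN_ge0//; first exact: mxN_sum.
by apply: sumr_ge0 => i _; exact: mxN_ge0.
Qed.

Lemma mxvanishes_to_map k m n (G : V -> 'M[R]_(m, n)) :
  vanishes_to k (fun h => `|G h|) ->
  mxvanishes_to k (fun h => map_mx (real_complex R) (G h)).
Proof.
move=> vG; apply: (vanishes_to_le _ _ _ (vanishes_toZ _ (m%:R * n%:R) _ vG)) => h.
rewrite ger0_norm ?mxN_ge0// ger0_norm ?mulr_ge0//.
apply: (@le_trans _ _ (\sum_(i < m) \sum_(j < n) `|G h|)).
  apply: ler_sum => i _; apply: ler_sum => j _; rewrite mxE normc_real.
  rewrite [leRHS]/Num.norm/= mx_normrE.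
  exact: (le_bigmax _ (fun ij : 'I_m * 'I_n => `|G h ij.1 ij.2|) (i, j)).
by rewrite !sumr_const !card_ord -[leLHS]mulr_natl -[X in m%:R * X <= _]mulr_natl mulrA.
Qed.

Lemma vanishes_to_entry k m n (F : V -> 'M[R]_(m, n)) i j :
  mxvanishes_to k (fun h => map_mx (real_complex R) (F h)) ->
  vanishes_to k (fun h => F h i j).
Proof.
move=> vF; apply: (vanishes_to_le _ _ _ vF) => h.
rewrite -normc_real ger0_norm ?mxN_ge0//.
have := mxN_entry _ _ (map_mx (real_complex R) (F h)) i j.
by rewrite mxE.
Qed.

End OrderOfVanishing.

(** * What an admissible contour provides *)

Section ContourData.
Context {R : realType}.

Lemma open_complex_gap (Omega : set (R[i]^o)) (z : R[i]) : open Omega ->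
  Omega z -> exists2 r : R, 0 < r & forall w, normc (w - z) < r -> Omega w.
Proof.
rewrite openE => oO /oO; rewrite /interior => /nbhs_ballP[e /= e0 be].
move: e0; rewrite ltcE => /andP[/eqP ie re].
exists (Re e) => // w wz; apply: be; rewrite /ball/=.
have -> : `|z - w| = (normc (w - z))%:C.
  by rewrite -normc_opp opprB; case: (z - w).
by rewrite ltcE /= ie eqxx.
Qed.

Lemma finite_gap (I : finType) (Omega : set (R[i]^o)) (z : I -> R[i]) :
  open Omega -> (forall i, Omega (z i)) ->
  exists2 r : R, 0 < r & forall i w, normc (w - z i) < r -> Omega w.
Proof.
move=> oO Oz.
pose rho i := projT1 (cid2 (open_complex_gap _ _ oO (Oz i))).
have rho0 i : 0 < rho i by rewrite /rho; case: cid2.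
have hrho i w : normc (w - z i) < rho i -> Omega w.
  by rewrite /rho; case: cid2 => r /= _; exact.
have s0 : 0 < 1 + \sum_i (rho i)^-1.
  by rewrite ltr_pwDl// sumr_ge0// => i _; rewrite invr_ge0 ltW.
(* A lower bound of all the radii that stays positive for an empty index set. *)
exists (1 + \sum_i (rho i)^-1)^-1; first by rewrite invr_gt0.
move=> i w wz; apply: (hrho i); apply: (lt_le_trans wz).
rewrite -[leRHS]invrK lef_pV2 ?posrE ?invr_gt0//.
rewrite (bigD1 i)//= addrCA lerDl addr_ge0// sumr_ge0// => j _.
by rewrite invr_ge0 ltW.
Qed.

Context {d n : nat} {M : 'M[R[i]]_d} {Omega : set (R[i]^o)}.
Context {Gamma : 'I_n -> R -> R[i]} (hG : sqrt_contour M Omega Gamma).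

Lemma sqrt_contour_smooth j : smooth_closed_curve (Gamma j).
Proof. by have [_ _ _ [h _ _ _ _] _] := hG; exact: h. Qed.

Lemma sqrt_contour_boundary j t : closure Omega (Gamma j t) /\ ~ Omega (Gamma j t).
Proof.
have [_ _ _ [_ _ e _ _] _] := hG.
suff : (closure Omega `\` Omega) (Gamma j t) by [].
by rewrite e; exists j, t.
Qed.

Lemma sqrt_contour_slit j t : slit_plane (Gamma j t).
Proof.
by have [_ _ sl _ _] := hG; apply: sl; have [] := sqrt_contour_boundary j t.
Qed.

Lemma sqrt_contour_winding (w : R[i]) : Omega w ->
  contour_integral Gamma (fun z => (z - w)^-1) = two_pi_i.
Proof.
have [_ _ _ [_ _ _ wi _] _] := hG; move=> /wi; rewrite /winding_number.
have h0 : two_pi_i != 0 :> R[i].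
  apply/eqP => /(congr1 (@complex.Im R))/eqP.
  by rewrite /= gt_eqF// mulr_gt0// pi_gt0.
by move=> /(congr1 (fun z => two_pi_i * z)); rewrite mulVKf// mulr1.
Qed.

End ContourData.

(** * Contour roots of positive definite matrices *)

Section ContourSquareRootOfSPD.
Context {R : realType} {d : nat}.
Implicit Types (A : 'M[R]_d) (lam : 'I_d -> R) (p : 'I_d -> 'cV[R]_d).

Lemma real_complex_sqrtK (x : R) : 0 < x -> (Num.sqrt x)%:C ^+ 2 = x%:C.
Proof. by move=> x0; rewrite -rmorphXn /= sqr_sqrtr// ltW. Qed.

Definition sqrt_eigenvalues lam i : R[i] := (Num.sqrt (lam i))%:C.
Definition complex_projections p i : 'M[R[i]]_d := toC (proj1d (p i)).

Lemma toC_spectral {A lam p} : eigen_decomposition A lam p ->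
  toC A = \sum_i sqrt_eigenvalues lam i ^+ 2 *: complex_projections p i.
Proof.
move=> [lam0 _ _ {1}->]; rewrite toC_eigen_sum; apply: eq_bigr => i _.
by rewrite real_complex_sqrtK.
Qed.

Lemma Re_sqrt_eigenvalues {A lam p} : eigen_decomposition A lam p ->
  forall i, 0 < Re (sqrt_eigenvalues lam i).
Proof. by move=> [lam0 _ _ _] i /=; rewrite sqrtr_gt0. Qed.

Lemma spectrum_gap {A lam p} {Omega : set (R[i]^o)} :
  eigen_decomposition A lam p -> open Omega ->
  (forall i, Omega (lam i)%:C) ->
  exists2 r : R, 0 < r & forall i w,
    normc (w - sqrt_eigenvalues lam i ^+ 2) < r -> Omega w.
Proof.
move=> [lam0 _ _ _] oO Ol; apply: finite_gap => // i.
by rewrite real_complex_sqrtK.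
Qed.

(** [M] is kept apart from [A]: the contour belongs to the base point, while the lemma is also
    applied at nearby matrices whose eigenvalues are still enclosed. *)
Lemma contour_sqrt_toC {A lam p} {M : 'M[R[i]]_d} {Omega : set (R[i]^o)} {n}
    {Gamma : 'I_n -> R -> R[i]} :
  eigen_decomposition A lam p -> sqrt_contour M Omega Gamma ->
  (forall i, Omega (lam i)%:C) -> contour_sqrt Gamma (toC A) = toC (spd_sqrt A).
Proof.
move=> dA hG Ol; have [oO _ _ _ _] := hG.
have [r r0 hr] := spectrum_gap dA oO Ol.
rewrite (spd_sqrtE dA) toC_eigen_sum (toC_spectral dA).
apply: (contour_sqrt_spectral _ (sqrt_contour_smooth hG) (sqrt_contour_slit hG)
  _ _ (toC_proj_mul dA) (toC_proj_sum dA) (Re_sqrt_eigenvalues dA) _ r) => //.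
  move=> i; apply: (sqrt_contour_winding hG); apply: (hr i).
  by rewrite subrr normc0.
(* A contour point closer than [r] to an eigenvalue would lie in [Omega], but the contour is its
   boundary. *)
move=> i j t; rewrite leNgt; apply/negP => /(hr i) hO.
by have [_] := sqrt_contour_boundary hG j t; apply.
Qed.

Lemma spectrum_eigen {A lam p} {Omega : set (R[i]^o)} :
  eigen_decomposition A lam p -> spectrum (toC A) `<=` Omega ->
  forall i, Omega (lam i)%:C.
Proof. by move=> dA sO i; apply: sO; exact: (eigen_in_spectrum dA i). Qed.

Lemma spectrum_stable {A lam p} {Omega : set (R[i]^o)} :
  eigen_decomposition A lam p -> open Omega -> spectrum (toC A) `<=` Omega ->
  exists2 delta : R, 0 < delta & forall H : 'M[R[i]]_d, mxN H <= delta ->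
    spectrum (toC A + H) `<=` Omega.
Proof.
move=> dA oO /(spectrum_eigen dA) Ol.
have [r r0 hr] := spectrum_gap dA oO Ol.
pose K := resolvent_bound (complex_projections p) r.
have K0 : 0 <= K by exact: resolvent_bound_ge0.
have K1 : 0 < K + 1 by rewrite ltr_wpDl.
exists (2 * (K + 1))^-1; first by rewrite invr_gt0 mulr_gt0.
move=> H Hs z; rewrite /spectrum/= (toC_spectral dA) => ez.
have KH : K * mxN H <= 2^-1.
  apply: (@le_trans _ _ ((K + 1) * mxN H)).
    by rewrite ler_wpM2r ?mxN_ge0// lerDl.
  apply: (le_trans (ler_wpM2l (ltW K1) Hs)).
  by rewrite invfM mulrCA mulfV ?mulr1// gt_eqF.
have [k] := eigenvalue_perturbation _ _ (toC_proj_mul dA) (toC_proj_sum dA)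
  _ r0 _ _ KH ez.
exact: hr.
Qed.

Lemma contour_sqrt_toC_expansion {A lam p} {Omega : set (R[i]^o)} {n}
    {Gamma : 'I_n -> R -> R[i]} :
  eigen_decomposition A lam p -> sqrt_contour (toC A) Omega Gamma ->
  exists2 delta, 0 < delta &
  exists2 C, 0 < C & forall H, mxN H <= delta ->
    mxN (contour_sqrt Gamma (toC A + H) - toC (spd_sqrt A) -
         sqrt_derivative (complex_projections p) (sqrt_eigenvalues lam) H)
    <= C * mxN H ^+ 2.
Proof.
move=> dA hG; have [oO _ _ _ sO] := hG.
have Ol := spectrum_eigen dA sO.
have [r r0 hr] := spectrum_gap dA oO Ol.
rewrite -(contour_sqrt_toC dA hG Ol) (toC_spectral dA).
apply: (contour_sqrt_expansion _ (sqrt_contour_smooth hG) (sqrt_contour_slit hG)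
  _ _ (toC_proj_mul dA) (toC_proj_sum dA) (Re_sqrt_eigenvalues dA) _ r) => //.
  move=> i; apply: (sqrt_contour_winding hG); apply: (hr i).
  by rewrite subrr normc0.
move=> i j t; rewrite leNgt; apply/negP => /(hr i) hO.
by have [_] := sqrt_contour_boundary hG j t; apply.
Qed.

Definition real_sqrt_derivative lam p (G : 'M[R]_d) :=
  \sum_i \sum_j (Num.sqrt (lam i) + Num.sqrt (lam j))^-1 *:
    (proj1d (p i) *m G *m proj1d (p j)).

Lemma toC_sqrt_derivative lam p G :
  sqrt_derivative (complex_projections p) (sqrt_eigenvalues lam) (toC G) =
  toC (real_sqrt_derivative lam p G).
Proof.
rewrite /toC map_mx_sum; apply: eq_bigr => i _.
rewrite map_mx_sum; apply: eq_bigr => j _.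
rewrite map_mxZ [map_mx _ (_ *m G *m _)]map_mxM [map_mx _ (_ *m G)]map_mxM.
by rewrite /sqrt_eigenvalues -rmorphD -fmorphV.
Qed.

Definition inv_sqrt lam p : 'M[R]_d :=
  \sum_i (Num.sqrt (lam i))^-1 *: proj1d (p i).

Context {A : 'M[R]_d} {lam : 'I_d -> R} {p : 'I_d -> 'cV[R]_d}.
Context (dA : eigen_decomposition A lam p).

Lemma real_spectral_sumM (a b : 'I_d -> R) :
  (\sum_i a i *: proj1d (p i)) *m (\sum_i b i *: proj1d (p i)) =
  \sum_i (a i * b i) *: proj1d (p i).
Proof.
have [_ PP _ _] := dA.
rewrite mulmx_suml; apply: eq_bigr => i _; rewrite mulmx_sumr (bigD1 i)//=.
rewrite -scalemxAl -scalemxAr PP eqxx scalerA big1 ?addr0// => j ji.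
by rewrite -scalemxAl -scalemxAr PP eq_sym (negbTE ji) !scaler0.
Qed.

Lemma inv_sqrtM : inv_sqrt lam p *m spd_sqrt A = 1%:M.
Proof.
rewrite (spd_sqrtE dA) real_spectral_sumM -(eigen_proj_sum dA).
apply: eq_bigr => i _; have [lam0 _ _ _] := dA.
by rewrite mulVf ?scale1r// gt_eqF// sqrtr_gt0.
Qed.

Lemma inv_sqrtMr : spd_sqrt A *m inv_sqrt lam p = 1%:M.
Proof. exact: mulmx1C inv_sqrtM. Qed.

Lemma spd_sqrt_trmx : (spd_sqrt A)^T = spd_sqrt A.
Proof.
rewrite (spd_sqrtE dA) raddf_sum; apply: eq_bigr => i _ /=.
by rewrite linearZ/= /proj1d trmx_mul trmxK.
Qed.

Lemma spd_sqrt_sylvester G :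
  spd_sqrt A *m real_sqrt_derivative lam p G +
  real_sqrt_derivative lam p G *m spd_sqrt A = G.
Proof.
have [lam0 PP _ _] := dA.
have SP i : spd_sqrt A *m proj1d (p i) = Num.sqrt (lam i) *: proj1d (p i).
  rewrite (spd_sqrtE dA) mulmx_suml (bigD1 i)//= -scalemxAl PP eqxx.
  by rewrite big1 ?addr0// => j ji; rewrite -scalemxAl PP (negbTE ji) scaler0.
have PS i : proj1d (p i) *m spd_sqrt A = Num.sqrt (lam i) *: proj1d (p i).
  rewrite (spd_sqrtE dA) mulmx_sumr (bigD1 i)//= -scalemxAr PP eqxx.
  by rewrite big1 ?addr0// => j ji; rewrite -scalemxAr PP eq_sym (negbTE ji) scaler0.
rewrite mulmx_sumr mulmx_suml -big_split/= -[RHS]mul1mx -(eigen_proj_sum dA).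
rewrite mulmx_suml; apply: eq_bigr => i _.
rewrite mulmx_sumr mulmx_suml -big_split/= -[RHS]mulmx1 -(eigen_proj_sum dA).
rewrite mulmx_sumr; apply: eq_bigr => j _.
move: (proj1d (p i)) (proj1d (p j)) (SP i) (PS j) => Pi Pj SPi PSj.
rewrite -scalemxAr -scalemxAl !mulmxA SPi -(mulmxA _ _ (spd_sqrt A)) PSj.
rewrite -!scalemxAl -scalemxAr -scalerDr -scalerDl scalerA mulVf ?scale1r//.
by rewrite gt_eqF// addr_gt0 ?sqrtr_gt0.
Qed.

Lemma inv_sqrt_sylvester G :
  real_sqrt_derivative lam p G *m inv_sqrt lam p +
  inv_sqrt lam p *m real_sqrt_derivative lam p G =
  inv_sqrt lam p *m G *m inv_sqrt lam p.
Proof.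
rewrite -{3}[G]spd_sqrt_sylvester mulmxDr mulmxDl !mulmxA inv_sqrtM mul1mx.
by rewrite -[in X in _ = _ + X]mulmxA inv_sqrtMr mulmx1.
Qed.

(** Separating the pairs of equal indices produces [(lam i)^-1]. The split is by index, so cross
    terms within a repeated eigenvalue stay in the second sum. *)
Lemma inv_sqrt_sandwich G :
  inv_sqrt lam p *m G *m inv_sqrt lam p =
  \sum_i (lam i)^-1 *: (proj1d (p i) *m G *m proj1d (p i)) +
  \sum_i \sum_(m | i != m) (Num.sqrt (lam i * lam m))^-1 *:
     (proj1d (p i) *m G *m proj1d (p m)).
Proof.
have [lam0 _ _ _] := dA.
rewrite -big_split/= {1}/inv_sqrt !mulmx_suml; apply: eq_bigr => i _.
rewrite mulmx_sumr (bigD1 i)//=; congr (_ + _).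
  rewrite -!scalemxAl -scalemxAr scalerA -invfM -expr2 sqr_sqrtr//.
  exact: ltW.
apply: eq_big => [m|m _]; first by rewrite eq_sym.
by rewrite -!scalemxAl -scalemxAr scalerA -invfM sqrtrM// ltW.
Qed.

End ContourSquareRootOfSPD.

(** * Second order expansion of the extension of Phi *)

Section DifferentialFromExpansion.
Context {R : realType} {V : normedModType R}.

(** The first hypothesis supplies the continuity of [L], the second a remainder that is quadratic
    and hence o(h). *)
Lemma differential_of_expansion (f : V -> R) (x : V) (L : {linear V -> R}) :
  vanishes_to 1 (fun h => L h) ->
  vanishes_to 2 (fun h => f (x + h) - f x - L h) ->
  differentiable f x /\ 'd f x = L :> (V -> R).
Proof.
move=> [C C0 hL] [D D0 hD].
have cL : continuous L.
  apply: bounded_linear_continuous; apply/ex_bound; exists C; near=> h.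
  apply: (@le_trans _ _ (C * `|h| ^+ 1)); first by near: h.
  have h1 : `|h| <= 1.
    by near: h; apply/nbhs_norm0P; exists 1 => //= h /ltW.
  by rewrite expr1 ler_piMr.
have eL : f \o shift x = cst (f x) + L +o_ (0 : V) id.
  apply/eqaddoP => e e0; have D1 : 0 < D + 1 by rewrite ltr_wpDl.
  near=> h.
  have -> : (f \o shift x - (cst (f x) + L)) h = f (x + h) - f x - L h.
    by rewrite /= fctE /= [h + x]addrC opprD addrA.
  apply: (@le_trans _ _ (D * `|h| ^+ 2)); first by near: h.
  rewrite expr2 mulrA ler_wpM2r//.
  apply: (@le_trans _ _ ((D + 1) * ((D + 1)^-1 * e))); last first.
    by rewrite mulrA mulfV ?mul1r// gt_eqF.
  apply: ler_pM => //; first by rewrite lerDl.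
  near: h; apply/nbhs_norm0P; exists ((D + 1)^-1 * e) => /=.
    by rewrite mulr_gt0// invr_gt0.
  by move=> h /ltW.
have dL := diff_unique cL eL; split=> //.
by apply/diff_locallyP; rewrite dL.
Unshelve. all: by end_near. Qed.

End DifferentialFromExpansion.

Section PhiExpansion.
Context {R : realType} {d : nat}.

Local Notation space := (('cV[R]_d * 'cV[R]_d) * ('M[R]_d * 'M[R]_d))%type.

Lemma dotE (u v : 'cV[R]_d) : dot u v = \sum_k u k 0 * v k 0.
Proof. by rewrite /dot mxE; apply: eq_bigr => k _; rewrite mxE. Qed.

Lemma dot_linearr (u v w : 'cV[R]_d) (c : R) :
  dot u (c *: v + w) = c * dot u v + dot u w.
Proof.
by rewrite /dot mulmxDr -scalemxAr !mxE.
Qed.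

Lemma dot_sqrD (u w : 'cV[R]_d) :
  dot (u + w) (u + w) = dot u u + 2 * dot u w + dot w w.
Proof.
rewrite !dotE mulr_sumr -!big_split/=; apply: eq_bigr => k _.
by rewrite !mxE; ring.
Qed.

Lemma quad_linear (u : 'cV[R]_d) (c : R) (M N : 'M[R]_d) :
  quad u (c *: M + N) = c * quad u M + quad u N.
Proof. by rewrite /quad mulmxDr mulmxDl -scalemxAr -scalemxAl !mxE. Qed.

Lemma quadD (u : 'cV[R]_d) (M N : 'M[R]_d) :
  quad u (M + N) = quad u M + quad u N.
Proof. by rewrite -[M]scale1r quad_linear mul1r scale1r. Qed.

Lemma quadZ (u : 'cV[R]_d) (c : R) (M : 'M[R]_d) :
  quad u (c *: M) = c * quad u M.
Proof. by rewrite /quad -scalemxAr -scalemxAl mxE. Qed.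

Lemma quad_sum (u : 'cV[R]_d) (I : finType) (P : pred I) (F : I -> 'M[R]_d) :
  quad u (\sum_(i | P i) F i) = \sum_(i | P i) quad u (F i).
Proof.
elim/big_rec2: _ => [|i x y _ <-]; last by rewrite quadD.
by rewrite /quad mulmx0 mul0mx mxE.
Qed.

Lemma quad_sumZ (u : 'cV[R]_d) (I : finType) (P : pred I) (c : I -> R)
    (F : I -> 'M[R]_d) :
  quad u (\sum_(i | P i) c i *: F i) = \sum_(i | P i) c i * quad u (F i).
Proof. by rewrite quad_sum; apply: eq_bigr => i _; exact: quadZ. Qed.

Lemma quad_tr (u : 'cV[R]_d) (M : 'M[R]_d) : quad u M = \tr (proj1d u *m M).
Proof.
rewrite /proj1d -mulmxA mxtrace_mulC /quad.
by rewrite [in RHS]/mxtrace big_ord1.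
Qed.

Lemma vanishes_to_components :
  [/\ vanishes_to 1 (fun h : space => `|h.1.1|),
      vanishes_to 1 (fun h : space => `|h.1.2|),
      vanishes_to 1 (fun h : space => `|h.2.1|) &
      vanishes_to 1 (fun h : space => `|h.2.2|)].
Proof.
by split; apply: (vanishes_to_le _ _ _ vanishes_to_norm) => h;
  rewrite !normr_id !prod_normE !le_max lexx ?orbT.
Qed.

Lemma mxvanishes_to_G : mxvanishes_to 1 (fun h : space => toC h.2.1).
Proof. by apply: mxvanishes_to_map; have [] := vanishes_to_components. Qed.

Lemma mxvanishes_to_G' : mxvanishes_to 1 (fun h : space => toC h.2.2).
Proof. by apply: mxvanishes_to_map; have [] := vanishes_to_components. Qed.

Lemma mxvanishes_to_sqrt_derivative k (P : 'I_d -> 'M[R[i]]_d)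
    (al : 'I_d -> R[i]) (F : space -> 'M[R[i]]_d) :
  mxvanishes_to k F -> mxvanishes_to k (fun h => sqrt_derivative P al (F h)).
Proof.
move=> vF; apply: mxvanishes_to_sum => i; apply: mxvanishes_to_sum => j.
by apply: mxvanishes_toZ; apply: mxvanishes_toMr; exact: mxvanishes_toMl.
Qed.

Lemma sqrt_derivativeD (P : 'I_d -> 'M[R[i]]_d) (al : 'I_d -> R[i])
    (X Y : 'M[R[i]]_d) :
  sqrt_derivative P al (X + Y) = sqrt_derivative P al X + sqrt_derivative P al Y.
Proof.
rewrite /sqrt_derivative -big_split/=; apply: eq_bigr => i _.
rewrite -big_split/=; apply: eq_bigr => j _.
by rewrite mulmxDr mulmxDl scalerDr.
Qed.

(** With [D] and [g] of order one and [E] of order two, each term on the right has order at least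
    two. *)
Lemma triple_product_expansion (s b g D E x b' m k : 'M[R[i]]_d) :
  x = s + (D + E) -> b' = b + g -> m = s *m b *m s ->
  k = D *m b *m s + s *m b *m D + s *m g *m s ->
  x *m b' *m x - m - k =
  (D + E) *m b *m (D + E) + (D + E) *m g *m (D + E) + (D + E) *m g *m s +
  s *m g *m (D + E) + s *m b *m E + E *m b *m s.
Proof.
move=> -> -> -> ->; rewrite !(mulmxDl, mulmxDr).
(* Once distributed, the noncommutative products become atoms, and what is left is an additive
   identity for [ring] in each entry. *)
repeat match goal with |- context [?x *m ?y *m ?z] =>
  generalize (x *m y *m z); intros ? end.
by apply/matrixP => i j; rewrite !mxE; ring.
Qed.

Lemma vanishes_to_dot (u : 'cV[R]_d) :
  vanishes_to 1 (fun h : space => dot u (h.1.1 - h.1.2)).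
Proof.
have [vg vg' _ _] := vanishes_to_components.
have v : mxvanishes_to 1
    (fun h : space => map_mx (real_complex R) (u^T *m (h.1.1 - h.1.2))).
  have -> : (fun h : space => map_mx (real_complex R) (u^T *m (h.1.1 - h.1.2))) =
    (fun h => map_mx (real_complex R) u^T *m (map_mx (real_complex R) h.1.1 +
      -1 *: map_mx (real_complex R) h.1.2)).
    by apply/funext => h; rewrite map_mxM map_mxB scaleN1r.
  apply: mxvanishes_toMl; apply: mxvanishes_toD; first exact: mxvanishes_to_map.
  by apply: mxvanishes_toZ; exact: mxvanishes_to_map.
exact: vanishes_to_entry v.
Qed.

Lemma vanishes_to_dot2 :
  vanishes_to 2 (fun h : space => dot (h.1.1 - h.1.2) (h.1.1 - h.1.2)).
Proof.
have [vg vg' _ _] := vanishes_to_components.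
have vd k : vanishes_to 1 (fun h : space => (h.1.1 - h.1.2) k 0).
  have vk := vanishes_to_dot (delta_mx k 0).
  apply: (vanishes_to_le _ _ _ vk) => h.
  rewrite dotE (bigD1 k)//= big1 ?addr0 => [|l lk]; last first.
    by rewrite mxE (negbTE lk) mul0r.
  by rewrite [delta_mx _ _ _ _]mxE !eqxx mul1r.
have := vanishes_to_sum _ _ (index_enum 'I_d) _
  (fun k => vanishes_toM 1 1 _ _ (vd k) (vd k)).
by under [X in _ -> vanishes_to _ X]eq_fun do rewrite dotE.
Qed.

Lemma vanishes_to_tr k (F : space -> 'M[R[i]]_d) :
  mxvanishes_to k F -> vanishes_to k (fun h => Re (\tr (F h))).
Proof.
move=> vF; apply: (vanishes_to_le _ _ _ vF) => h.
rewrite [leRHS]ger0_norm ?mxN_ge0//.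
exact: le_trans (normr_Re_le _) (mxN_tr _ _).
Qed.

Lemma Re_tr_toC (X : 'M[R]_d) : Re (\tr (toC X)) = \tr X.
Proof. by rewrite /toC trace_map_mx. Qed.

Lemma spd_sandwich (X Y : 'M[R]_d) : X^T = X -> X \in unitmx -> spd Y ->
  spd (X *m Y *m X).
Proof.
move=> sX uX [sY pY]; split; first by rewrite !trmx_mul sX sY mulmxA.
move=> v v0.
have -> : v^T *m (X *m Y *m X) *m v = (X *m v)^T *m Y *m (X *m v).
  by rewrite trmx_mul sX !mulmxA.
apply: pY; apply: contra v0 => /eqP h.
by rewrite -[v]mul1mx -(mulVmx uX) -mulmxA h mulmx0.
Qed.

Context {A B : 'M[R]_d} {lam kap : 'I_d -> R} {p q : 'I_d -> 'cV[R]_d}.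
Context (dA : eigen_decomposition A lam p).
Context (dM : eigen_decomposition (spd_sqrt A *m B *m spd_sqrt A) kap q).
Context {Omega1 : set (R[i]^o)} {n1 : nat} {Gamma1 : 'I_n1 -> R -> R[i]}.
Context (hG1 : sqrt_contour (toC A) Omega1 Gamma1).
Context {Omega2 : set (R[i]^o)} {n2 : nat} {Gamma2 : 'I_n2 -> R -> R[i]}.
Context (hG2 : sqrt_contour (toC (spd_sqrt A *m B *m spd_sqrt A)) Omega2 Gamma2).

Local Notation S := (spd_sqrt A).
Local Notation T := (inv_sqrt lam p).
Local Notation L := (real_sqrt_derivative lam p).

Definition inner_root (h : space) := contour_sqrt Gamma1 (toC (A + h.2.1)).

Definition middle_product (h : space) :=
  inner_root h *m toC (B + h.2.2) *m inner_root h.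

Definition middle_derivative (h : space) :=
  L h.2.1 *m B *m S + S *m B *m L h.2.1 + S *m h.2.2 *m S.

Lemma mxvanishes_to_L : mxvanishes_to 1 (fun h : space => toC (L h.2.1)).
Proof.
have := mxvanishes_to_sqrt_derivative 1 (complex_projections p)
  (sqrt_eigenvalues lam) _ mxvanishes_to_G.
by under [X in mxvanishes_to _ X]eq_fun do rewrite toC_sqrt_derivative.
Qed.

Lemma inner_root_expansion :
  mxvanishes_to 2 (fun h => inner_root h - toC S - toC (L h.2.1)).
Proof.
have [delta d0 [C C0 hC]] := contour_sqrt_toC_expansion dA hG1.
apply: (vanishes_to_near_le 1 2 C _ _ mxvanishes_to_G); first exact: ltW.
near=> h; rewrite [X in X <= _]ger0_norm ?mxN_ge0//.
rewrite [X in _ * X ^+ 2]ger0_norm ?mxN_ge0//.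
rewrite -toC_sqrt_derivative /inner_root [toC (A + _)]map_mxD; apply: hC.
rewrite -[leLHS]ger0_norm ?mxN_ge0//.
by near: h; exact: vanishes_to_small mxvanishes_to_G d0.
Unshelve. all: by end_near. Qed.

Lemma middle_product_expansion :
  mxvanishes_to 2 (fun h => middle_product h - toC (S *m B *m S)
    - toC (middle_derivative h)).
Proof.
pose E h := inner_root h - toC S - toC (L h.2.1).
have vE : mxvanishes_to 2 E := inner_root_expansion.
have vL := mxvanishes_to_L.
have vX : mxvanishes_to 1 (fun h : space => toC (L h.2.1) + E h).
  by apply: mxvanishes_toD => //; exact: vanishes_to_weaken.
have -> : (fun h => middle_product h - toC (S *m B *m S)
    - toC (middle_derivative h)) = (fun h =>
    let D := toC (L h.2.1) in let s := toC S in let b := toC B in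
    let g := toC h.2.2 in let E := E h in
  (D + E) *m b *m (D + E) + (D + E) *m g *m (D + E) + (D + E) *m g *m s +
  s *m g *m (D + E) + s *m b *m E + E *m b *m s).
  apply/funext => h; apply: triple_product_expansion.
  - rewrite /E; move: (inner_root h) (toC S) (toC (L _)) => X Y Z.
    by apply/matrixP => i j; rewrite !mxE; ring.
  - exact: map_mxD.
  - by rewrite /toC !map_mxM.
  - by rewrite /toC !map_mxD !map_mxM.
have vg := mxvanishes_to_G'.
have vXg := mxvanishes_toM _ _ _ _ _ _ _ vX vg.
have vXb := mxvanishes_toMr _ _ _ _ _ (toC B) vX.
have vsg := mxvanishes_toMl _ _ _ _ (toC S) _ vg.
apply: mxvanishes_toD; last by apply: mxvanishes_toMr; exact: mxvanishes_toMr.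
apply: mxvanishes_toD; last exact: mxvanishes_toMl.
apply: mxvanishes_toD; last exact: (mxvanishes_toM 1 1 _ _ _ _ _ vsg vX).
apply: mxvanishes_toD; last exact: mxvanishes_toMr.
apply: mxvanishes_toD; first exact: (mxvanishes_toM 1 1 _ _ _ _ _ vXb vX).
(* The product of three increments is of order three, one more than required. *)
by apply: vanishes_to_weaken; exact: (mxvanishes_toM 2 1 _ _ _ _ _ vXg vX).
Qed.

Lemma middle_derivative_vanishes :
  mxvanishes_to 1 (fun h => toC (middle_derivative h)).
Proof.
have vL := mxvanishes_to_L.
have -> : (fun h => toC (middle_derivative h)) = (fun h : space =>
    toC (L h.2.1) *m toC B *m toC S + toC S *m toC B *m toC (L h.2.1) +
    toC S *m toC h.2.2 *m toC S).
  by apply/funext => h; rewrite /toC !map_mxD !map_mxM.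
apply: mxvanishes_toD; first apply: mxvanishes_toD.
- by apply: mxvanishes_toMr; exact: mxvanishes_toMr.
- exact: mxvanishes_toMl.
- by apply: mxvanishes_toMr; apply: mxvanishes_toMl; exact: mxvanishes_to_G'.
Qed.

Lemma middle_product_vanishes :
  mxvanishes_to 1 (fun h => middle_product h - toC (S *m B *m S)).
Proof.
have := mxvanishes_toD _ _ _ _ _
  (vanishes_to_weaken _ _ middle_product_expansion) middle_derivative_vanishes.
by under [X in mxvanishes_to _ X -> _]eq_fun do rewrite subrK.
Qed.

(** The root is expanded at the full increment of the middle product. Replacing that increment by
    its linear part changes the linear term by the derivative of a second-order quantity. *)
Lemma outer_root_expansion :
  mxvanishes_to 2 (fun h => contour_sqrt Gamma2 (middle_product h)
    - toC (spd_sqrt (S *m B *m S))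
    - toC (real_sqrt_derivative kap q (middle_derivative h))).
Proof.
have [delta d0 [C C0 hC]] := contour_sqrt_toC_expansion dM hG2.
pose H h := middle_product h - toC (S *m B *m S).
pose D := sqrt_derivative (complex_projections q) (sqrt_eigenvalues kap).
have vH : mxvanishes_to 1 H := middle_product_vanishes.
have v1 : mxvanishes_to 2 (fun h => contour_sqrt Gamma2 (middle_product h)
    - toC (spd_sqrt (S *m B *m S)) - D (H h)).
  apply: (vanishes_to_near_le 1 2 C _ _ vH); first exact: ltW.
  near=> h; rewrite [X in X <= _]ger0_norm ?mxN_ge0//.
  rewrite [X in _ * X ^+ 2]ger0_norm ?mxN_ge0//.
  have -> : middle_product h = toC (S *m B *m S) + H h.
    by rewrite /H addrC subrK.
  apply: hC; rewrite -[leLHS]ger0_norm ?mxN_ge0//.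
  by near: h; exact: vanishes_to_small vH d0.
have v2 := mxvanishes_to_sqrt_derivative 2 (complex_projections q)
  (sqrt_eigenvalues kap) _ middle_product_expansion.
have := mxvanishes_toD _ _ _ _ _ v1 v2.
have <- // : (fun h => contour_sqrt Gamma2 (middle_product h)
    - toC (spd_sqrt (S *m B *m S))
    - toC (real_sqrt_derivative kap q (middle_derivative h))) =
  (fun h => contour_sqrt Gamma2 (middle_product h)
    - toC (spd_sqrt (S *m B *m S)) - D (H h) +
    D (H h - toC (middle_derivative h))).
apply/funext => h; rewrite -toC_sqrt_derivative.
have lin (X U Y Z K : 'M[R[i]]_d) : Y = Z + K -> X - U - K = X - U - Y + Z.
  by move=> ->; apply/matrixP => i j; rewrite !mxE; ring.
by apply: lin; rewrite /D -sqrt_derivativeD subrK.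
Unshelve. all: by end_near. Qed.

(** By cyclicity only equal indices survive, with weight [1 / (2 sqrt kap)]; the 2 cancels the one
    in [Phi]. *)
Lemma tr_sqrt_derivative (K : 'M[R]_d) :
  2 * \tr (real_sqrt_derivative kap q K) =
  \sum_k (Num.sqrt (kap k))^-1 * quad (q k) K.
Proof.
have [kap0 QQ _ _] := dM.
rewrite raddf_sum mulr_sumr; apply: eq_bigr => k _ /=.
rewrite raddf_sum (bigD1 k)//= big1 ?addr0 => [|l lk].
  rewrite mxtraceZ mxtrace_mulC (mulmxA (proj1d _) (proj1d _)) QQ eqxx -quad_tr.
  have k0 : Num.sqrt (kap k) != 0 by rewrite gt_eqF// sqrtr_gt0.
  by field; rewrite k0 -mulr2n mulrn_eq0.
rewrite mxtraceZ mxtrace_mulC (mulmxA (proj1d _) (proj1d _)) QQ (negbTE lk).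
by rewrite mul0mx mxtrace0 mulr0.
Qed.

Context (sB : B^T = B).

Lemma quad_middle_derivative k (h : space) :
  quad (q k) (middle_derivative h) =
  kap k * quad (q k) (T *m h.2.1 *m T) + quad (q k) (S *m h.2.2 *m S).
Proof.
rewrite /middle_derivative !quadD; congr (_ + _).
(* The eigenvector equation of the middle product, multiplied on the left by the inverse root. *)
have BSq : B *m S *m q k = kap k *: (T *m q k).
  by rewrite scalemxAr -(eigen_vector dM) !mulmxA (inv_sqrtM dA) mul1mx.
have qSB : (q k)^T *m S *m B = kap k *: ((q k)^T *m T).
  apply: trmx_inj; rewrite linearZ/= !trmx_mul !trmxK sB (spd_sqrt_trmx dA).
  have -> : T^T = T.
    rewrite /inv_sqrt raddf_sum; apply: eq_bigr => i _ /=.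
    by rewrite linearZ/= /proj1d trmx_mul trmxK.
  by rewrite mulmxA.
rewrite -(inv_sqrt_sylvester dA) quadD mulrDr; congr (_ + _).
  rewrite /quad !mulmxA -(mulmxA _ B) -(mulmxA _ (B *m S)) BSq.
  by rewrite -scalemxAr mxE !mulmxA.
by rewrite /quad !mulmxA qSB -!scalemxAl mxE.
Qed.

(** Bridge between the stated formula and the chain of expansions; linearity, boundedness and the
    final comparison all use this form. *)
Lemma dPhi_simpl (mu nu : 'cV[R]_d) (h : space) :
  dPhi (fun i m => i != m) mu nu A lam p kap q h =
  2 * dot (mu - nu) (h.1.1 - h.1.2) + \tr h.2.1 + \tr h.2.2
  - 2 * \tr (real_sqrt_derivative kap q (middle_derivative h)).
Proof.
have [kap0 _ _ _] := dM.
case: h => [[g g'] [G G']]; rewrite /dPhi /= tr_sqrt_derivative.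
have e : \sum_k (Num.sqrt (kap k))^-1 *
    quad (q k) (middle_derivative (g, g', (G, G'))) =
  \sum_l Num.sqrt (kap l) *
      \sum_i (lam i)^-1 * quad (q l) (proj1d (p i) *m G *m proj1d (p i)) +
  \sum_l (Num.sqrt (kap l))^-1 * quad (q l) (S *m G' *m S) +
  \sum_l Num.sqrt (kap l) *
      \sum_i \sum_(m | i != m) (Num.sqrt (lam i * lam m))^-1 *
        quad (q l) (proj1d (p i) *m G *m proj1d (p m)).
  rewrite -!big_split/=; apply: eq_bigr => k _.
  rewrite quad_middle_derivative/= (inv_sqrt_sandwich dA) quadD.
  rewrite quad_sumZ quad_sum.
  under [X in _ * (_ * (_ + X) + _)]eq_bigr do rewrite quad_sumZ.
  move: (\sum_i _) (\sum_i \sum_(_ | _) _) (quad _ _) => a b c.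
  have k0 : Num.sqrt (kap k) != 0 by rewrite gt_eqF// sqrtr_gt0.
  rewrite -{2}[kap k]sqr_sqrtr ?ltW//.
  by field.
by rewrite e; ring.
Qed.

Lemma dPhi_linear (mu nu : 'cV[R]_d) :
  linear (dPhi (fun i m => i != m) mu nu A lam p kap q).
Proof.
move=> c [[g1 g1'] [G1 G1']] [[g2 g2'] [G2 G2']]; rewrite !dPhi_simpl.
rewrite !tr_sqrt_derivative /GRing.scale/=.
have -> : c *: g1 + g2 - (c *: g1' + g2') = c *: (g1 - g1') + (g2 - g2').
  by rewrite scalerBr opprD addrACA.
rewrite dot_linearr !mxtraceD !mxtraceZ.
have e : \sum_k (Num.sqrt (kap k))^-1 * quad (q k) (middle_derivative
    (c *: g1 + g2, c *: g1' + g2', (c *: G1 + G2, c *: G1' + G2'))) =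
  c * (\sum_k (Num.sqrt (kap k))^-1 * quad (q k) (middle_derivative
    (g1, g1', (G1, G1')))) +
  \sum_k (Num.sqrt (kap k))^-1 * quad (q k) (middle_derivative
    (g2, g2', (G2, G2'))).
  rewrite mulr_sumr -big_split/=; apply: eq_bigr => k _.
  rewrite !quad_middle_derivative/= !mulmxDr !mulmxDl -!scalemxAr -!scalemxAl.
  by rewrite !quad_linear; ring.
by rewrite e; ring.
Qed.

Lemma dPhi_vanishes (mu nu : 'cV[R]_d) :
  vanishes_to 1 (dPhi (fun i m => i != m) mu nu A lam p kap q).
Proof.
have -> : dPhi (fun i m => i != m) mu nu A lam p kap q = (fun h : space =>
    2 * dot (mu - nu) (h.1.1 - h.1.2) + Re (\tr (toC h.2.1)) +
    Re (\tr (toC h.2.2)) + -2 * Re (\tr (sqrt_derivative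
     (complex_projections q) (sqrt_eigenvalues kap) (toC (middle_derivative h))))).
  by apply/funext => h; rewrite dPhi_simpl toC_sqrt_derivative !Re_tr_toC mulNr.
apply: vanishes_toD; last first.
  apply: vanishes_toZ; apply: vanishes_to_tr; apply: mxvanishes_to_sqrt_derivative.
  exact: middle_derivative_vanishes.
apply: vanishes_toD; last by apply: vanishes_to_tr; exact: mxvanishes_to_G'.
apply: vanishes_toD; last by apply: vanishes_to_tr; exact: mxvanishes_to_G.
by apply: vanishes_toZ; exact: vanishes_to_dot.
Qed.

(** All linear terms cancel exactly, leaving the squared length of [g - g'] and the trace of the
    outer remainder. *)
Lemma Phi_ext_expansion (mu nu : 'cV[R]_d) :
  vanishes_to 2 (fun h : space =>
    Phi_ext Gamma1 Gamma2 (((mu, nu), (A, B)) + h) -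
    Phi_ext Gamma1 Gamma2 ((mu, nu), (A, B)) -
    dPhi (fun i m => i != m) mu nu A lam p kap q h).
Proof.
have [_ _ _ _ sO1] := hG1; have [_ _ _ _ sO2] := hG2.
have e1 := contour_sqrt_toC dA hG1 (spectrum_eigen dA sO1).
have e2 := contour_sqrt_toC dM hG2 (spectrum_eigen dM sO2).
have -> : (fun h : space =>
    Phi_ext Gamma1 Gamma2 (((mu, nu), (A, B)) + h) -
    Phi_ext Gamma1 Gamma2 ((mu, nu), (A, B)) -
    dPhi (fun i m => i != m) mu nu A lam p kap q h) = (fun h =>
    dot (h.1.1 - h.1.2) (h.1.1 - h.1.2) + -2 * Re (\tr (
      contour_sqrt Gamma2 (middle_product h) - toC (spd_sqrt (S *m B *m S))
    - toC (real_sqrt_derivative kap q (middle_derivative h))))).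
  apply/funext => h; rewrite dPhi_simpl.
  have -> : Re (\tr (contour_sqrt Gamma2 (middle_product h)
      - toC (spd_sqrt (S *m B *m S))
      - toC (real_sqrt_derivative kap q (middle_derivative h)))) =
    Re (\tr (contour_sqrt Gamma2 (middle_product h)))
      - \tr (spd_sqrt (S *m B *m S))
      - \tr (real_sqrt_derivative kap q (middle_derivative h)).
    by rewrite !raddfB/= !Re_tr_toC.
  have -> : Phi_ext Gamma1 Gamma2 ((mu, nu), (A, B)) =
    dot (mu - nu) (mu - nu) + \tr A + \tr B - 2 * \tr (spd_sqrt (S *m B *m S)).
    by rewrite /Phi_ext e1 -!map_mxM e2 Re_tr_toC.
  case: h => [[g g'] [G G']].
  rewrite /Phi_ext /middle_product /inner_root /=.
  have -> : mu + g - (nu + g') = (mu - nu) + (g - g').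
    by rewrite opprD addrACA.
  rewrite dot_sqrD !mxtraceD; move: (Re _) (\tr (real_sqrt_derivative _ _ _)) => a b.
  by ring.
apply: vanishes_toD; first exact: vanishes_to_dot2.
by apply: vanishes_toZ; apply: vanishes_to_tr; exact: outer_root_expansion.
Qed.

Lemma Phi_ext_eq_Phi (mu nu : 'cV[R]_d) : \forall h \near (0 : space),
  spd (A + h.2.1) -> spd (B + h.2.2) ->
  Phi_ext Gamma1 Gamma2 (((mu, nu), (A, B)) + h) = Phi (((mu, nu), (A, B)) + h).
Proof.
have [oO1 _ _ _ sO1] := hG1; have [oO2 _ _ _ sO2] := hG2.
have [d1 d10 h1] := spectrum_stable dA oO1 sO1.
have [d2 d20 h2] := spectrum_stable dM oO2 sO2.
near=> h => sA' sB'.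
have [lam' [p' dA']] := spd_eigen_decomposition _ sA'.
have sp1 : spectrum (toC (A + h.2.1)) `<=` Omega1.
  rewrite [toC (A + _)]map_mxD; apply: h1.
  rewrite -[leLHS]ger0_norm ?mxN_ge0//.
  by near: h; exact: vanishes_to_small mxvanishes_to_G d10.
have e1 := contour_sqrt_toC dA' hG1 (spectrum_eigen dA' sp1).
have sM : spd (spd_sqrt (A + h.2.1) *m (B + h.2.2) *m spd_sqrt (A + h.2.1)).
  apply: spd_sandwich => //; first exact: (spd_sqrt_trmx dA').
  by have /mulmx1_unit[] := inv_sqrtM dA'.
have [kap' [q' dM']] := spd_eigen_decomposition _ sM.
(* Since the inner contour root is now the spectral one, the middle product is again positive
   definite, and the outer root can be compared in the same way. *)
have eM : middle_product h =
    toC (spd_sqrt (A + h.2.1) *m (B + h.2.2) *m spd_sqrt (A + h.2.1)).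
  by rewrite /middle_product /inner_root e1 -!map_mxM.
have sp2 : spectrum (toC (spd_sqrt (A + h.2.1) *m (B + h.2.2) *m
    spd_sqrt (A + h.2.1))) `<=` Omega2.
  have -> : toC (spd_sqrt (A + h.2.1) *m (B + h.2.2) *m spd_sqrt (A + h.2.1)) =
    toC (S *m B *m S) + (middle_product h - toC (S *m B *m S)).
    by rewrite eM [RHS]addrC subrK.
  apply: h2; rewrite -[leLHS]ger0_norm ?mxN_ge0//.
  by near: h; exact: vanishes_to_small middle_product_vanishes d20.
have e2 := contour_sqrt_toC dM' hG2 (spectrum_eigen dM' sp2).
have : Re (\tr (contour_sqrt Gamma2 (middle_product h))) =
    \tr (spd_sqrt (spd_sqrt (A + h.2.1) *m (B + h.2.2) *m spd_sqrt (A + h.2.1))).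
  by rewrite eM e2 Re_tr_toC.
rewrite /middle_product /inner_root; clear.
by case: h => [[g g'] [G G']]; rewrite /Phi_ext /Phi /= => ->.
Unshelve. all: by end_near. Qed.

End PhiExpansion.

Theorem lemma2p4 (R : realType) (d : nat)
    (mu nu : 'cV[R]_d) (A B : 'M[R]_d)
    (hA : spd A) (hB : spd B)
    (Omega1 : set (R[i]^o)) (n1 : nat) (Gamma1 : 'I_n1 -> R -> R[i])
    (hGamma1 : sqrt_contour (toC A) Omega1 Gamma1)
    (Omega2 : set (R[i]^o)) (n2 : nat) (Gamma2 : 'I_n2 -> R -> R[i])
    (hGamma2 : sqrt_contour (toC (spd_sqrt A *m B *m spd_sqrt A))
                 Omega2 Gamma2) :
  let x : ('cV[R]_d * 'cV[R]_d) * ('M[R]_d * 'M[R]_d) :=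
    ((mu, nu), (A, B)) in
  [/\ \forall y \near x, spd y.2.1 -> spd y.2.2 ->
        Phi_ext Gamma1 Gamma2 y = Phi y,
      differentiable (Phi_ext Gamma1 Gamma2) x
    & forall (lam : 'I_d -> R) (p : 'I_d -> 'cV[R]_d)
             (kap : 'I_d -> R) (q : 'I_d -> 'cV[R]_d),
        eigen_decomposition A lam p ->
        eigen_decomposition (spd_sqrt A *m B *m spd_sqrt A) kap q ->
        (forall h, 'd (Phi_ext Gamma1 Gamma2) x h =
           dPhi (fun i m => i != m) mu nu A lam p kap q h) /\
        (injective lam ->
         forall h, 'd (Phi_ext Gamma1 Gamma2) x h =
           dPhi (fun i m => lam i != lam m) mu nu A lam p kap q h)].
Proof.
move=> x.
have [sB _] := hB.
have main lam p kap q (dA : eigen_decomposition A lam p)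
    (dM : eigen_decomposition (spd_sqrt A *m B *m spd_sqrt A) kap q) :
    differentiable (Phi_ext Gamma1 Gamma2) x /\
    forall h, 'd (Phi_ext Gamma1 Gamma2) x h =
      dPhi (fun i m => i != m) mu nu A lam p kap q h.
  pose D : {linear _ -> R} := HB.pack
    (dPhi (fun i m => i != m) mu nu A lam p kap q)
    (GRing.isLinear.Build _ _ _ _ _ (dPhi_linear dA dM sB mu nu)).
  have [dP dE] := differential_of_expansion (Phi_ext Gamma1 Gamma2) x D
    (dPhi_vanishes dA dM sB mu nu)
    (Phi_ext_expansion dA dM hGamma1 hGamma2 sB mu nu).
  by split=> // h; rewrite dE.
(* The first two claims mention no decomposition, so one is chosen for them. *)
have [lam0 [p0 dA0]] := spd_eigen_decomposition _ hA.
have sM : spd (spd_sqrt A *m B *m spd_sqrt A).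
  apply: spd_sandwich => //; first exact: (spd_sqrt_trmx dA0).
  by have /mulmx1_unit[] := inv_sqrtM dA0.
have [kap0 [q0 dM0]] := spd_eigen_decomposition _ sM.
split.
- apply/nbhs0P.
  exact: (Phi_ext_eq_Phi dA0 dM0 hGamma1 hGamma2 mu nu).
- by have [] := main _ _ _ _ dA0 dM0.
- move=> lam p kap q dA dM; have [_ dE] := main _ _ _ _ dA dM.
  split=> [//|lam_inj h]; rewrite dE.
  (* Only the last double sum depends on the selector, and for injective [lam] both selectors
     agree. *)
  case: h => [[g g'] [G G']]; rewrite /dPhi; congr (_ - _).
  apply: eq_bigr => l _; congr (_ * _); apply: eq_bigr => i _.
  by apply: eq_bigl => m; rewrite (inj_eq lam_inj).
Qed.
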